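(* Let $G$ be a $d$-regular graph on $n$ vertices with $d=\omega(\log n)$, let $l$ be a positive integer with $l=\omega(1)$ and $l=o(\log_d n)$, and suppose $G$ has girth at least $10hl$, where $k:=\max\{4,\lfloor l/\sqrt{\log_d n}\rfloor\}$ and $h:=\left\lceil \frac{\log\log n}{\log(k-2)}\right\rceil$. Let $m^*$ be the maximum load after the algorithm $\mathcal{A}(G,l)$ has allocated $n$ balls, and let $\gamma_G=\sqrt{\log_d n}$. Then with high probability: (I) if $\omega(1)\le l\le 4\gamma_G$, then $m^*=\mathcal{O}\!\left(\frac{\log_d n\cdot\log\log n}{l^2}\right)$; (II) if $l\ge 4\gamma_G$, then $m^*=\mathcal{O}\!\left(\frac{\log\log n}{\log(l/\gamma_G)}\right)$.
   Context: The $n$ vertices of $G$ are bins. A non-backtracking random walk (NBRW) of length $l$ from a vertex is a walk of $l$ steps in which at each step the walker moves to a uniformly random neighbour of its current vertex, with the constraint that it never traverses the same edge twice in a row. Algorithm $\mathcal{A}(G,l)$: for $t=1,\dots,n$, ball $t$ picks a vertex of $G$ uniformly at random, performs an NBRW of length $l$ from it, and is placed on a vertex of minimum current load among the visited vertices, ties broken uniformly at random. The load of a vertex is the number of balls placed on it. Asymptotics are as $n\to\infty$; ''with high probability'' means with probability $1-n^{-c}$ for some constant $c>0$. *)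

(* Defs.v *)
From HB Require Import structures.
From mathcomp Require Import all_boot all_order all_algebra.
From mathcomp Require Import all_classical all_reals all_analysis.
Import Order.TTheory GRing.Theory Num.Theory.
Import numFieldNormedType.Exports.

Set Implicit Arguments.
Unset Strict Implicit.
Unset Printing Implicit Defensive.

Local Open Scope ring_scope.

Section Graphs.
Variables (T : finType) (e : rel T).

Definition simple_graph : Prop := symmetric e /\ irreflexive e.

Definition neighbours (u : T) : {set T} := [set v | e u v]%SET.

Definition regular (d : nat) : Prop := forall u, #|neighbours u| = d.

(* [ucycle e c] alone also accepts an edge traversed back and forth (size 2)
   and the empty sequence, hence the size condition.  The infimum of the empty
   set is +oo, so forests have infinite girth. *)
Definition girth (R : realType) : \bar R :=
  ereal_inf [set (size c)%:R%:E | c in [set c : seq T | (2 < size c)%N /\ ucycle e c]]%classic.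

End Graphs.

Arguments girth {T} e R.

Section Process.
Variables (R : realType) (T : finType) (e : rel T).

(* The probability of [x] under the uniform law on [A]. *)
Definition unif (A : {set T}) (x : T) : R := (x \in A)%:R / #|A|%:R.

(* In a simple graph the edge just traversed is the one leading back to the
   previous vertex [prev]; [prev = None] at the start of the walk. *)
Definition nb_next (prev : option T) (u : T) : {set T} :=
  [set v in neighbours e u | prev != Some v]%SET.

(* The probability that a non-backtracking walk standing at [u], having come
   from [prev], visits next the vertices of [p], in this order. *)
Fixpoint nbrw_prob (prev : option T) (u : T) (p : seq T) : R :=
  if p is v :: p' then unif (nb_next prev u) v * nbrw_prob (Some u) v p' else 1.

Definition least_loaded (x : T -> nat) (s : seq T) : {set T} :=
  [set v | (v \in s) && all (fun w => x v <= x w)%N s]%SET.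

Variables (m l : nat).

(* What happens to one ball: [b.1.1] is the starting vertex of its walk,
   [b.1.2] lists the [l] vertices visited after it, and [b.2] is the vertex on
   which the ball is placed. *)
Definition ball : finType := (T * l.-tuple T * T)%type.

(* The joint outcome for the [m] balls, which arrive in the order of 'I_m. *)
Definition history : finType := {ffun 'I_m -> ball}.

(* The load of [v] when the balls [s < t] have been allocated. *)
Definition load (w : history) (t : nat) (v : T) : nat :=
  #|[set s : 'I_m | (s < t)%N && ((w s).2 == v)]%SET|.

Definition max_load (w : history) : nat := \max_(v : T) load w m v.

(* The conditional probability of the outcome [b] for a ball, given the loads
   [x] that it finds: start, walk, then uniform choice among the least loaded
   vertices of the walk. *)
Definition ball_prob (x : T -> nat) (b : ball) : R :=
  unif [set: T] b.1.1 * nbrw_prob None b.1.1 b.1.2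
  * unif (least_loaded x (b.1.1 :: b.1.2)) b.2.

Definition history_prob (w : history) : R :=
  \prod_(t < m) ball_prob (load w t) (w t).

Definition alloc_prob (A : pred history) : R := \sum_(w | A w) history_prob w.

End Process.

Arguments load {T m l}.
Arguments max_load {T m l}.
Arguments alloc_prob R {T} e m l.

Section Quantities.
Variable R : realType.

(* The library only has the natural logarithm [ln]. *)
Definition logb (b x : R) : R := ln x / ln b.

Definition gammaG (n d : nat) : R := Num.sqrt (logb d%:R n%:R).

Definition kpar (n d l : nat) : int :=
  Num.max 4%:Z (Num.floor (l%:R / gammaG n d)).

Definition hpar (n d l : nat) : int :=
  Num.ceil (ln (ln n%:R) / ln ((kpar n d l - 2)%:~R : R)).

End Quantities.

(* Main.v *)
Require Import Defs.
From HB Require Import structures.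
From mathcomp Require Import all_boot all_order all_algebra.
From mathcomp Require Import all_classical all_reals all_analysis.
From mathcomp Require Import ring lra zify.
Import Order.TTheory GRing.Theory Num.Theory.
Import numFieldNormedType.Exports.

Local Open Scope classical_set_scope.
Local Open Scope ring_scope.

Set Implicit Arguments.
Unset Strict Implicit.
Unset Printing Implicit Defensive.

(**
Say that a ball has height [c] when the vertex receiving it had load [c]; then
every vertex of its walk had load at least [c].  In a regular graph a uniformly
started non-backtracking walk is reversible, so a ball's walk meets a given
vertex [w] with probability at most [(l+1)/n], and from [w] at least [l/2]
further steps are still free on one side.

- Constant level.  Cut the [n] balls into [C] batches.  While every
  neighbourhood has at most half of its vertices above [C] times the current
  batch index, a walk meets a positive fraction of lowest vertices, hence a ball
  of at least that height falls on a given vertex with probability [O(1/n)].  As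
  [d] dominates [ln n], Chernoff's bound propagates the property, and at the end
  all neighbourhoods are sparse above some constant level [c].
- Layers.  If at most a fraction [eta] of every neighbourhood has load at least
  [c], a ball reaches a given vertex at height [c] with probability at most
  [(l+1) eta^(l/2) / n]; so, again by Chernoff, the fraction at level [c+1] is at
  most about [eta^(l/4)], until it reaches [d^(-1/4)].
- Top.  If a ball has height [c+k], its walk is one of the [n d^l] simple paths
  all of whose [l+1] vertices received [k] balls of height at least [c].  Each
  such ball costs a factor [(l+1)^2 eta^(l/2)], so [k] is of order
  [ln n / (l^2 ln (1/eta))].

If [d <= (ln n)^4] no layer is needed, as [ln d = O(ln (ln n))]; otherwise
[ln (ln n) / ln (l/4)] layers give [ln (1/eta) = (ln d)/4].  The girth is only
used to know that walks of length [l] are simple paths.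
*)

(** * Sums over finite histories *)

Section SequentialSums.
Variables (R : realType) (B : finType) (m : nat).
Implicit Types (w : {ffun 'I_m -> B}) (t : 'I_m) (b : B).

Definition upd w t b : {ffun 'I_m -> B} := [ffun s => if s == t then b else w s].

Definition prefix_dep (F : 'I_m -> {ffun 'I_m -> B} -> R) :=
  forall t w w', (forall s : 'I_m, (s <= t)%N -> w s = w' s) -> F t w = F t w'.

Variables (b0 : B) (F : 'I_m -> {ffun 'I_m -> B} -> R).
Hypothesis Fdep : prefix_dep F.

(** Histories equal to [b0] from time [k] on stand for histories of length [k], so that the
    induction on length stays in one finite type. *)
Let padded k : pred {ffun 'I_m -> B} :=
  fun w => [forall s : 'I_m, (k <= s)%N ==> (w s == b0)].

Let partial k := \sum_(w | padded k w) \prod_(t < m | (t < k)%N) F t w.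

Let partial0 : partial 0 = 1.
Proof.
rewrite /partial (big_pred1 [ffun=> b0]) => [|w]; first by rewrite big_pred0.
apply/forallP/eqP => [h|-> s]; last by rewrite ffunE eqxx implybT.
by apply/ffunP => s; rewrite ffunE; apply/eqP; apply: (implyP (h s)).
Qed.

Let partialm : partial m = \sum_w \prod_(t < m) F t w.
Proof.
apply: eq_big => [w|w _].
  by apply/forallP => s; rewrite leqNgt ltn_ord.
by apply: eq_bigl => t; rewrite ltn_ord.
Qed.

Let partialS (k : 'I_m) :
  partial k.+1 = \sum_(w | padded k w)
    (\prod_(t < m | (t < k)%N) F t w) * \sum_b F k (upd w k b).
Proof.
(* Each padded history is grouped with its reset to [b0] at [k]; the earlier factors are constant on
   a group. *)
rewrite /partial (partition_big (fun w => upd w k b0) (padded k)) /=; last first.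
  move=> w /forallP h; apply/forallP => s; apply/implyP => ks.
  rewrite ffunE; case: ifPn => // nsk; apply: (implyP (h s)).
  by rewrite ltn_neqAle ks andbT eq_sym.
apply: eq_bigr => w /forallP hw.
rewrite (reindex_onto (upd w k) (fun w' => w' k)) /=; last first.
  move=> w' /andP[_ /eqP <-]; apply/ffunP => s; rewrite !ffunE.
  by case: eqVneq => // ->.
rewrite mulr_sumr; apply: eq_big => [b|b _].
  rewrite ffunE eqxx eqxx andbT; apply/andP; split.
    apply/forallP => s; apply/implyP => ks; rewrite ffunE.
    case: ifP => [/eqP sk|_]; first by rewrite sk ltnn in ks.
    by apply: (implyP (hw s)); apply: ltnW.
  apply/eqP/ffunP => s; rewrite !ffunE; case: eqVneq => // ->.
  by rewrite (eqP (implyP (hw k) (leqnn _))).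
rewrite (bigD1 k) ?ltnSn //= mulrC; congr (_ * _).
apply: eq_big => [t|t].
  by rewrite ltnS ltn_neqAle andbC; congr (_ && _).
move=> /andP[tk ntk]; apply: Fdep => s st; rewrite ffunE.
case: eqVneq => // sk; move: st; rewrite sk => kt.
have /eqP tk' : t == k by rewrite -(inj_eq val_inj) eqn_leq kt -ltnS tk.
by rewrite tk' eqxx in ntk.
Qed.

Let prod_ltnS (c : 'I_m -> R) (k : 'I_m) :
  \prod_(t < m | (t < k.+1)%N) c t = (\prod_(t < m | (t < k)%N) c t) * c k.
Proof.
rewrite (bigD1 k) ?ltnSn //= mulrC; congr (_ * _).
by apply: eq_bigl => t; rewrite ltnS ltn_neqAle andbC; congr (_ && _).
Qed.

(** The last factor is summed out first: given any past its sum is at most [c k], and the earlier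
    factors do not see it. *)
Lemma sum_prod_seq_le (c : 'I_m -> R) :
  (forall t w, 0 <= F t w) -> (forall t w, \sum_b F t (upd w t b) <= c t) ->
  \sum_w \prod_(t < m) F t w <= \prod_(t < m) c t.
Proof.
move=> F0 Fc; rewrite -partialm.
have -> : \prod_(t < m) c t = \prod_(t < m | (t < m)%N) c t.
  by apply: eq_bigl => t; rewrite ltn_ord.
have c0 t : 0 <= c t.
  by apply: le_trans (Fc t [ffun=> b0]); apply: sumr_ge0.
suff: forall k, (k <= m)%N -> partial k <= \prod_(t < m | (t < k)%N) c t by move=> /(_ m); apply.
elim=> [|k IH] km; first by rewrite partial0 big_pred0.
rewrite (partialS (Ordinal km)) (prod_ltnS c (Ordinal km)).
apply: (@le_trans _ _ (partial k * c (Ordinal km))); last first.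
  by apply: ler_wpM2r => //; apply: IH; apply: ltnW.
rewrite mulr_suml; apply: ler_sum => w _; apply: ler_wpM2l => //.
by apply: prodr_ge0.
Qed.

Lemma sum_prod_seq_eq1 :
  (forall t w, \sum_b F t (upd w t b) = 1) -> \sum_w \prod_(t < m) F t w = 1.
Proof.
move=> F1; rewrite -partialm.
suff: forall k, (k <= m)%N -> partial k = 1 by move=> /(_ m); apply.
elim=> [|k IH] km; first by rewrite partial0.
rewrite (partialS (Ordinal km)) -[RHS](IH (ltnW km)).
by apply: eq_bigr => w _; rewrite F1 mulr1.
Qed.

End SequentialSums.

(** * Tail bounds for the allocation process *)

Lemma load_agree (T : finType) (m l : nat) (w w' : history T m l) (k : nat) :
  (forall s : 'I_m, (s < k)%N -> w s = w' s) -> load w k = load w' k.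
Proof.
move=> ww'; apply/boolp.funext => v; apply: eq_card => s; rewrite !inE.
by case: ltnP => //= sk; rewrite ww'.
Qed.

Section Allocation.
Variables (R : realType) (T : finType) (e : rel T) (m l : nat).
Implicit Types (w : history T m l) (b : Defs.ball T l) (y : T -> nat) (A : pred (history T m l)).

Lemma unif_ge0 (A : {set T}) x : 0 <= unif R A x.
Proof. by rewrite /unif divr_ge0. Qed.

Lemma sum_unif (A : {set T}) (f : T -> R) :
  \sum_x unif R A x * f x = (\sum_(x in A) f x) / #|A|%:R.
Proof.
rewrite mulr_suml [RHS]big_mkcond /=; apply: eq_bigr => x _.
by rewrite /unif; case: (x \in A); rewrite ?mul1r ?mul0r // mulrC.
Qed.

Lemma sum_unif1 (A : {set T}) : (0 < #|A|)%N -> \sum_x unif R A x = 1.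
Proof.
move=> A0; have := sum_unif A (fun=> 1); under eq_bigr do rewrite mulr1.
by move=> ->; rewrite sumr_const divff // pnatr_eq0 -lt0n.
Qed.

Lemma nbrw_prob_ge0 prev u p : 0 <= nbrw_prob R e prev u p.
Proof.
elim: p prev u => [|v p IH] prev u //=.
by rewrite mulr_ge0 ?unif_ge0.
Qed.

Lemma ball_prob_ge0 y b : 0 <= ball_prob R e y b.
Proof. by rewrite /ball_prob !mulr_ge0 ?unif_ge0 ?nbrw_prob_ge0. Qed.

Lemma history_prob_ge0 w : 0 <= history_prob R e w.
Proof. by apply: prodr_ge0 => t _; apply: ball_prob_ge0. Qed.

(** The implication is asked only on histories of positive probability, so that the walks in them
    can be taken to be non-backtracking. *)
Lemma alloc_prob_le A A' :
  (forall w, history_prob R e w != 0 -> A w -> A' w) ->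
  alloc_prob R e m l A <= alloc_prob R e m l A'.
Proof.
move=> AA'; rewrite /alloc_prob big_mkcond [leRHS]big_mkcond /=.
apply: ler_sum => w _; case: ifP => Aw; last first.
  by case: ifP => // _; apply: history_prob_ge0.
case: ifPn => // A'w.
have [->//|/AA'/(_ Aw) A'w'] := eqVneq (history_prob R e w) 0.
by rewrite A'w' in A'w.
Qed.

Lemma alloc_probU A A' :
  alloc_prob R e m l (predU A A') <= alloc_prob R e m l A + alloc_prob R e m l A'.
Proof.
rewrite /alloc_prob big_mkcond [X in _ <= X + _]big_mkcond /=.
rewrite [X in _ <= _ + X]big_mkcond -big_split /=; apply: ler_sum => w _.
rewrite /in_mem /=; have := history_prob_ge0 w.
by case: (A w); case: (A' w); rewrite /= ?addr0 ?add0r // => h; rewrite lerDl.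
Qed.

Lemma alloc_prob_bigU (I : finType) (D : pred I) (A : I -> pred (history T m l)) :
  alloc_prob R e m l (fun w => [exists i in D, A i w])
    <= \sum_(i in D) alloc_prob R e m l (A i).
Proof.
rewrite /alloc_prob; under [leRHS]eq_bigr do rewrite big_mkcond /=.
rewrite exchange_big /= big_mkcond; apply: ler_sum => w _.
have p0 := history_prob_ge0 w.
case: ifP => [/existsP[i /andP[Di Ai]]|_]; last first.
  by apply: sumr_ge0 => i _; case: ifP.
rewrite (bigD1 i) //= Ai lerDl; apply: sumr_ge0 => j _; by case: ifP.
Qed.

Lemma alloc_probC A : \sum_(w : history T m l) history_prob R e w = 1 ->
  alloc_prob R e m l A = 1 - alloc_prob R e m l (predC A).
Proof. by move=> <-; rewrite (bigID A) /= addrK. Qed.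

Let prefix_ball (f : 'I_m -> (T -> nat) -> Defs.ball T l -> R) :
  prefix_dep (fun t w => f t (load w t) (w t)).
Proof.
move=> t w w' ww'; rewrite ww' // (@load_agree _ _ _ w w') // => s /ltnW.
exact: ww'.
Qed.

Let load_upd w (t : 'I_m) b : load (upd w t b) t = load w t.
Proof.
apply: load_agree => s st; rewrite ffunE; case: eqVneq => // sE.
by rewrite sE ltnn in st.
Qed.

Lemma sum_history_prob (b0 : Defs.ball T l) :
  (forall y, \sum_(b : Defs.ball T l) ball_prob R e y b = 1) -> \sum_(w : history T m l) history_prob R e w = 1.
Proof.
move=> b1; rewrite /history_prob.
apply: (sum_prod_seq_eq1 b0 (F := fun t w => ball_prob R e (load w t) (w t))).
  exact: (prefix_ball (fun t y b => ball_prob R e y b)).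
move=> t w; rewrite -(b1 (load w t)); apply: eq_bigr => b _.
by rewrite load_upd ffunE eqxx.
Qed.

(* Chernoff's method: the count is dominated by a sum of independent
   indicators, although the events depend on the past. *)
Lemma alloc_tail (b0 : Defs.ball T l) (a : 'I_m -> (T -> nat) -> Defs.ball T l -> bool)
    (p : 'I_m -> R) (x q : R) : 0 <= x ->
  (forall y, \sum_(b : Defs.ball T l) ball_prob R e y b <= 1) ->
  (forall t y, \sum_(b : Defs.ball T l) ball_prob R e y b * (a t y b)%:R <= p t) ->
  alloc_prob R e m l (fun w => q <= #|[set t | a t (load w t) (w t)]%SET|%:R)
    <= expR (expR x * \sum_t p t - x * q).
Proof.
move=> x0 b1 hp.
pose g t y b : R := ball_prob R e y b * (if a t y b then expR x else 1).
have gE w : \prod_(t < m) g t (load w t) (w t)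
    = history_prob R e w * expR (x * #|[set t | a t (load w t) (w t)]%SET|%:R).
  rewrite big_split /=; congr (_ * _).
  rewrite -big_mkcond /= prodr_const expRM_natr.
  by congr (_ ^+ _); apply: eq_card => t; rewrite inE.
have : \sum_w \prod_(t < m) g t (load w t) (w t)
    <= \prod_(t < m) expR (expR x * p t).
  apply: (sum_prod_seq_le b0 (F := fun t w => g t (load w t) (w t))).
  - exact: prefix_ball.
  - by move=> t w; rewrite mulr_ge0 ?ball_prob_ge0 //; case: ifP => // _; apply: expR_ge0.
  move=> t w; set y := load w t.
  under eq_bigr do rewrite load_upd ffunE eqxx.
  have x1 : 1 <= expR x by rewrite -expR0 ler_expR.
  (* The weight is [1 + (expR x - 1)] times the indicator; its mean is at most [1 + expR x * p t],
     hence at most [expR (expR x * p t)]. *)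
  have -> : \sum_b g t y b = \sum_(b : Defs.ball T l) ball_prob R e y b
      + (expR x - 1) * \sum_(b : Defs.ball T l) ball_prob R e y b * (a t y b)%:R.
    rewrite mulr_sumr -big_split /=; apply: eq_bigr => b _; rewrite /g.
    by case: (a t y b); rewrite /= ?mulr1 ?mulr0 ?addr0 //; ring.
  apply: (@le_trans _ _ (1 + expR x * p t)); last exact: expR_ge1Dx.
  apply: lerD => //; apply: (@le_trans _ _ ((expR x - 1) * p t)).
    by apply: ler_wpM2l => //; lra.
  have pt0 : 0 <= p t.
    apply: le_trans (hp t y); apply: sumr_ge0 => b _.
    by rewrite mulr_ge0 ?ball_prob_ge0.
  by apply: ler_wpM2r => //; lra.
rewrite -expR_sum -mulr_sumr => hs.
(* Markov's inequality for the exponential of the count. *)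
rewrite expRD -[leLHS](mulfK (lt0r_neq0 (expR_gt0 (x * q)))) expRN.
apply: ler_wpM2r; first by rewrite invr_ge0 expR_ge0.
apply: le_trans hs; rewrite /alloc_prob mulr_suml big_mkcond /=.
apply: ler_sum => w _; rewrite gE; case: ifP => [qw|_].
  apply: ler_wpM2l; first exact: history_prob_ge0.
  by rewrite ler_expR ler_wpM2l.
by rewrite mulr_ge0 ?history_prob_ge0 ?expR_ge0.
Qed.

End Allocation.

(** * Non-backtracking walks *)

Lemma leq_double_pred k : (1 < k)%N -> (k <= 2 * k.-1)%N.
Proof. by lia. Qed.

Lemma uphalf_le_sub k i : (i <= k./2)%N -> (uphalf k <= k - i)%N.
Proof. by rewrite uphalf_half; lia. Qed.

Lemma uphalf_le k i : (k./2 < i)%N -> (uphalf k <= i)%N.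
Proof. by rewrite uphalf_half; lia. Qed.

Section SequenceSums.
Variables (R : realType) (T : finType).
Implicit Types (f : seq T -> R).

Definition sumseq (m : nat) f : R := \sum_(p : m.-tuple T) f p.

Lemma sumseq0 f : sumseq 0 f = f [::].
Proof. rewrite /sumseq (big_pred1 [tuple]) // => t.
by apply/esym/eqP; apply: tuple0. Qed.

Lemma sumseqS m f : sumseq m.+1 f = \sum_v sumseq m (fun p => f (v :: p)).
Proof.
rewrite /sumseq pair_bigA /=.
rewrite (reindex (fun vp : T * m.-tuple T => [tuple of vp.1 :: vp.2])) //=.
exists (fun t : m.+1.-tuple T => (thead t, [tuple of behead t])) => [[v p] _|t _] /=.
  by congr (_, _); apply: val_inj.
by rewrite [RHS]tuple_eta.
Qed.

Lemma eq_sumseq m f g : (forall p, size p = m -> f p = g p) -> sumseq m f = sumseq m g.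
Proof. by move=> fg; apply: eq_bigr => p _; rewrite fg ?size_tuple. Qed.

Lemma ler_sumseq m f g :
  (forall p, size p = m -> f p <= g p) -> sumseq m f <= sumseq m g.
Proof. by move=> fg; apply: ler_sum => p _; rewrite fg ?size_tuple. Qed.

Lemma sumseqZ m a f : sumseq m (fun p => a * f p) = a * sumseq m f.
Proof. by rewrite /sumseq mulr_sumr. Qed.

Lemma sumseq_cat a b f :
  sumseq (a + b) f = sumseq a (fun p => sumseq b (fun q => f (p ++ q))).
Proof.
elim: a f => [|a IH] f; first by rewrite sumseq0.
by rewrite addSn !sumseqS; apply: eq_bigr => v _; rewrite IH.
Qed.

Lemma sumseq_rev m f : sumseq m f = sumseq m (fun p => f (rev p)).
Proof.
rewrite /sumseq (reindex_inj (h := fun t : m.-tuple T => [tuple of rev t])) //.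
by move=> s t /(congr1 val) /= /(congr1 rev); rewrite !revK => /val_inj.
Qed.

Lemma exchange_sumseq a b (f : seq T -> seq T -> R) :
  sumseq a (fun p => sumseq b (f p)) = sumseq b (fun q => sumseq a (f^~ q)).
Proof. exact: exchange_big. Qed.

End SequenceSums.

Section Walks.
Variables (R : realType) (T : finType) (e : rel T) (d : nat).
Hypotheses (e_sym : symmetric e) (e_irr : irreflexive e) (e_reg : regular e d).
Hypothesis d_gt1 : (1 < d)%N.

Local Notation nbrw := (nbrw_prob R e).

Lemma in_nb_next prev u v : (v \in nb_next e prev u) = e u v && (prev != Some v).
Proof. by rewrite !inE. Qed.

Lemma nb_next_None u : nb_next e None u = neighbours e u.
Proof. by apply/setP => v; rewrite in_nb_next inE andbT. Qed.

Lemma card_nb_next v u : e u v -> #|nb_next e (Some v) u| = d.-1.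
Proof.
move=> uv; have := cardsD1 v (neighbours e u); rewrite e_reg inE uv add1n => ->.
apply: eq_card => x; rewrite in_nb_next !inE andbC; congr (_ && _).
by congr (~~ _); apply/eqP/eqP => [[->]|->].
Qed.

Lemma card_nb_next_ge prev u : (d.-1 <= #|nb_next e prev u|)%N.
Proof.
case: prev => [v|]; last by rewrite nb_next_None e_reg leq_pred.
have [/card_nb_next ->//|uv] := boolP (e u v).
have -> : nb_next e (Some v) u = neighbours e u.
  apply/setP => x; rewrite in_nb_next inE; case: eqP => [[<-]|]; last by rewrite andbT.
  by rewrite (negbTE uv).
by rewrite e_reg leq_pred.
Qed.

Lemma card_nb_next_gt0 prev u : (0 < #|nb_next e prev u|)%N.
Proof. by apply: leq_trans (card_nb_next_ge prev u); case: d d_gt1 => [|[]]. Qed.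

Lemma unif_sym w u : unif R (nb_next e None w) u = unif R (nb_next e None u) w.
Proof. by rewrite /unif !in_nb_next !nb_next_None !e_reg e_sym. Qed.

(** For distinct neighbours [w], [z] of [u] both sides equal [1 / (d (d - 1))]; otherwise both
    vanish. *)
Lemma unif_swap w u z :
  unif R (nb_next e None u) w * unif R (nb_next e (Some w) u) z
  = unif R (nb_next e None u) z * unif R (nb_next e (Some z) u) w.
Proof.
rewrite /unif !in_nb_next !nb_next_None !e_reg !andbT.
have [uw|] := boolP (e u w); last by rewrite !mul0r mulr0.
have [uz|] := boolP (e u z); last by rewrite !mul0r mulr0.
rewrite !card_nb_next //=; congr (_ * (_ / _)); congr (nat_of_bool (~~ _))%:R.
by apply/eqP/eqP => -[->].
Qed.

Definition walk_prob (x : seq T) : R := if x is s :: p then nbrw None s p else 0.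

(** By reversibility the walk can be generated from [w]: backwards along [A], then forwards along
    [B] with the first edge of [A] forbidden. *)
Lemma walk_prob_split A w B :
  walk_prob (rev A ++ w :: B) = nbrw None w A * nbrw (ohead A) w B.
Proof.
elim: A w B => [|u A IH] w B; first by rewrite mul1r.
rewrite rev_cons cat_rcons IH /=.
rewrite (unif_sym w u); case: A {IH} => [|z A] /=; first by rewrite !mul1r mulr1.
by rewrite mulrACA -unif_swap; ring.
Qed.

(* Reversibility of the walk, seen from an inner vertex. *)
Lemma nbrw_flip A w B :
  nbrw None w A * nbrw (ohead A) w B = nbrw None w B * nbrw (ohead B) w A.
Proof.
case: A B => [|z A] [|y B] /=; rewrite ?mul1r ?mulr1 //.
by rewrite mulrACA unif_swap; ring.
Qed.

Lemma unif_supp (A : {set T}) v : unif R A v != 0 -> v \in A.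
Proof. by rewrite /unif; case: (v \in A); rewrite ?mul0r ?eqxx. Qed.

Lemma nbrw_supp prev u p : nbrw prev u p != 0 -> path e u p.
Proof.
elim: p prev u => [//|v p IH] prev u /=; rewrite mulf_eq0 negb_or => /andP[].
by move=> /unif_supp; rewrite in_nb_next => /andP[-> _] /IH ->.
Qed.

Lemma nbrw_supp_None prev u p : nbrw prev u p != 0 -> nbrw None u p != 0.
Proof.
case: p => [//|v p] /=; rewrite !mulf_eq0 !negb_or => /andP[+ ->]; rewrite andbT.
rewrite /unif in_nb_next nb_next_None e_reg inE; case: (e u v) => /= [_|].
  by rewrite oner_eq0 invr_eq0 pnatr_eq0; case: d d_gt1.
by rewrite eqxx.
Qed.

(* A walk that returns to its starting vertex closes a cycle of length at most
   its own; steps back along the last edge are excluded, so the cycle has at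
   least three vertices. *)
Lemma walk_uniq k (x : seq T) :
  (forall c : seq T, (2 < size c)%N -> ucycle e c -> (k < size c)%N) ->
  (size x <= k.+1)%N -> walk_prob x != 0 -> uniq x.
Proof.
move=> girth_k; elim: x => [//|s p IH] /= sp h.
have up : uniq p.
  case: p IH sp h => [//|v p] IH sp; rewrite /= mulf_eq0 negb_or => /andP[_ h].
  by apply: IH; [apply: ltnW | apply: nbrw_supp_None h].
rewrite up andbT; apply/negP => /splitPr sE.
case: sE sp h up => p1 p2 sp h up.
have pp := nbrw_supp h.
have : (2 < size (s :: p1))%N.
  case: p1 {up sp} h pp => [|a [|b p1]] //= h; first by rewrite e_irr.
  move: h; rewrite mulf_eq0 negb_or => /andP[_]; rewrite mulf_eq0 negb_or.
  by case/andP => /unif_supp; rewrite in_nb_next eqxx andbF.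
move/girth_k => /(_ _)/wrap[].
  rewrite /ucycle /=; move: pp; rewrite cat_path => /andP[pp1 /= /andP[h1 _]].
  rewrite rcons_path pp1 h1 /=; move: up.
  rewrite cat_uniq /= => /and3P[-> /norP[-> _] _]//.
move: sp; rewrite size_cat /= ltnS => sp /leq_trans/(_ (leq_trans _ sp)).
by rewrite ltnn addnS ltnS leq_addr => /(_ isT).
Qed.

Definition walk_mean prev u m (f : seq T -> R) : R :=
  sumseq m (fun q => nbrw prev u q * f q).

Lemma walk_mean0 prev u f : walk_mean prev u 0 f = f [::].
Proof. by rewrite /walk_mean sumseq0 mul1r. Qed.

Lemma walk_meanS prev u m f :
  walk_mean prev u m.+1 f
  = \sum_v unif R (nb_next e prev u) v * walk_mean (Some u) v m (fun q => f (v :: q)).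
Proof.
rewrite /walk_mean sumseqS; apply: eq_bigr => v _; rewrite -sumseqZ.
by apply: eq_sumseq => p _; rewrite /= mulrA.
Qed.

Lemma walk_mean1 prev u m : walk_mean prev u m (fun=> 1) = 1.
Proof.
elim: m prev u => [|m IH] prev u; first by rewrite walk_mean0.
rewrite walk_meanS; under eq_bigr do rewrite IH mulr1.
by rewrite sum_unif1 ?card_nb_next_gt0.
Qed.

Lemma ler_walk_mean prev u m f g :
  (forall p, size p = m -> f p <= g p) -> walk_mean prev u m f <= walk_mean prev u m g.
Proof.
by move=> fg; apply: ler_sumseq => p sp; rewrite ler_wpM2l ?nbrw_prob_ge0 ?fg.
Qed.

(* One of the two sides of [w] on the walk has at least [l/2] steps, and only
   that side is used. *)
Lemma hit_mean_le (l : nat) (w : T) (Phi G : seq T -> R) (kappa : R) :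
  (forall a b, (size a + size b)%N = l -> walk_prob (a ++ w :: b) != 0 ->
     Phi (a ++ w :: b) <= G b /\ Phi (a ++ w :: b) <= G (rev a)) ->
  (forall x, 0 <= Phi x) ->
  (forall prev m, (uphalf l <= m)%N -> walk_mean prev w m G <= kappa) ->
  sumseq l.+1 (fun x => walk_prob x * ((w \in x)%:R * Phi x)) <= l.+1%:R * kappa.
Proof.
move=> hPhi Phi0 hG.
have wp0 x : 0 <= walk_prob x by case: x => [|s p] //=; apply: nbrw_prob_ge0.
(* The position [i] of [w] is fixed here; the factor [l + 1] comes from the union over positions. *)
have side i : (i <= l)%N ->
    sumseq l.+1 (fun x => walk_prob x * ((nth w x i == w)%:R * Phi x)) <= kappa.
  move=> il; rewrite -[l.+1](subnKC (n := l.+1) (m := i)); last exact: leqW.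
  rewrite sumseq_cat subSn //.
  have -> : sumseq i (fun A => sumseq (l - i).+1 (fun B =>
        walk_prob (A ++ B) * ((nth w (A ++ B) i == w)%:R * Phi (A ++ B))))
      = sumseq i (fun A => sumseq (l - i) (fun B =>
          walk_prob (A ++ w :: B) * Phi (A ++ w :: B))).
    apply: eq_sumseq => A sA; rewrite sumseqS (bigD1 w) //= [X in _ + X]big1.
      rewrite addr0; apply: eq_sumseq => B _.
      by rewrite nth_cat sA ltnn subnn eqxx mul1r.
    move=> v vw; rewrite /sumseq big1 // => B _.
    by rewrite nth_cat sA ltnn subnn /= (negbTE vw) mul0r mulr0.
  rewrite sumseq_rev.
  (* Given the short side [A], the mean over the long side [B] is at most [kappa]. *)
  have [il2|il2] := leqP i l./2.
    apply: (@le_trans _ _ (walk_mean None w i (fun=> kappa))); last first.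
      rewrite /walk_mean -[leRHS]mulr1 -(walk_mean1 None w i) /walk_mean.
      rewrite -sumseqZ; apply: ler_sumseq => p _; by rewrite mulr1 mulrC.
    apply: ler_sumseq => A sA.
    apply: (@le_trans _ _ (nbrw None w A * walk_mean (ohead A) w (l - i) G)).
      rewrite /walk_mean -sumseqZ; apply: ler_sumseq => B sB.
      rewrite mulrA -walk_prob_split.
      have [->|h] := eqVneq (walk_prob (rev A ++ w :: B)) 0; first by rewrite !mul0r.
      apply: ler_wpM2l => //; apply: (hPhi _ _ _ h).1.
      by rewrite size_rev sA sB subnKC.
    by apply: ler_wpM2l; [apply: nbrw_prob_ge0 | apply/hG/uphalf_le_sub].
  (* Now [A] is the long side; [nbrw_flip] lets it be averaged given [B]. *)
  rewrite exchange_sumseq.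
  apply: (@le_trans _ _ (walk_mean None w (l - i) (fun=> kappa))); last first.
    rewrite /walk_mean -[leRHS]mulr1 -(walk_mean1 None w (l - i)) /walk_mean.
    rewrite -sumseqZ; apply: ler_sumseq => p _; by rewrite mulr1 mulrC.
  apply: ler_sumseq => B sB.
  apply: (@le_trans _ _ (nbrw None w B * walk_mean (ohead B) w i G)).
    rewrite /walk_mean -sumseqZ; apply: ler_sumseq => A sA.
    rewrite mulrA -nbrw_flip -walk_prob_split.
    have [->|h] := eqVneq (walk_prob (rev A ++ w :: B)) 0; first by rewrite !mul0r.
    apply: ler_wpM2l => //; rewrite -[in leRHS](revK A); apply: (hPhi _ _ _ h).2.
    by rewrite size_rev sA sB subnKC.
  by apply: ler_wpM2l; [apply: nbrw_prob_ge0 | apply/hG/uphalf_le].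
apply: (@le_trans _ _ (\sum_(i < l.+1)
    sumseq l.+1 (fun x => walk_prob x * ((nth w x i == w)%:R * Phi x)))); last first.
  rewrite -[in leRHS](card_ord l.+1) -sum1_card natr_sum mulr_suml.
  by apply: ler_sum => i _; rewrite mul1r; apply: side; rewrite -ltnS.
rewrite /sumseq exchange_big /=; apply: ler_sum => x _.
rewrite -mulr_sumr ler_wpM2l //.
have [wx|_] := boolP (w \in tval x); last first.
  by rewrite mul0r; apply: sumr_ge0 => i _; rewrite mulr_ge0.
have ix : (index w x < l.+1)%N by rewrite -[X in (_ < X)%N](size_tuple x) index_mem.
rewrite (bigD1 (Ordinal ix)) //= nth_index // eqxx lerDl.
by apply: sumr_ge0 => i _; rewrite mulr_ge0.
Qed.

End Walks.

(** * Placement of one ball *)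

Section Placement.
Variables (R : realType) (T : finType) (e : rel T) (d l : nat).
Hypotheses (e_sym : symmetric e) (e_irr : irreflexive e) (e_reg : regular e d).
Hypothesis d_gt3 : (3 < d)%N.
Hypothesis girth_l : forall c : seq T, (2 < size c)%N -> ucycle e c -> (l < size c)%N.
Implicit Types (y : T -> nat) (b : Defs.ball T l).

Let d_gt1 : (1 < d)%N. Proof. by apply: ltn_trans d_gt3. Qed.

(** The fraction is taken of [d - 1], the least number of choices at a non-backtracking step. *)
Definition sparse y (c : nat) (eta : R) : bool :=
  [forall u, #|[set v in neighbours e u | (c <= y v)%N]%SET|%:R <= eta * d.-1%:R].

(** Whatever edge is excluded, a step lands on a vertex of load at least [c] with probability at
    most [eta]. *)
Lemma walk_mean_high y c (eta : R) prev u m : 0 <= eta -> sparse y c eta ->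
  walk_mean e prev u m (fun q => (all (fun v => (c <= y v)%N) q)%:R) <= eta ^+ m.
Proof.
move=> eta0 /forallP sp; elim: m prev u => [|m IH] prev u.
  by rewrite walk_mean0 expr0.
rewrite walk_meanS.
apply: (@le_trans _ _ (\sum_v unif R (nb_next e prev u) v * ((c <= y v)%N%:R * eta ^+ m))).
  apply: ler_sum => v _; apply: ler_wpM2l; first exact: unif_ge0.
  rewrite -(mulr1 (walk_mean _ _ _ _ _)) /=.
  case: (c <= y v)%N => /=; first by rewrite mul1r mulr1; apply: IH.
  by rewrite mul0r mulr1 /walk_mean /sumseq big1 // => q _; rewrite mulr0.
under eq_bigr do rewrite mulrA.
rewrite -mulr_suml exprS ler_wpM2r ?exprn_ge0 // sum_unif.
have N0 := card_nb_next_ge e_reg prev u.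
have d1 : (0 < d.-1)%N by move: d_gt3; case: d => [|[]].
rewrite ler_pdivrMr ?ltr0n ?(leq_trans d1) //.
apply: (@le_trans _ _ (eta * d.-1%:R)); last by rewrite ler_wpM2l // ler_nat.
apply: le_trans (sp u); rewrite -natr_sum ler_nat -sum1_card.
rewrite [leqLHS]big_mkcond [leqRHS]big_mkcond /=; apply: leq_sum => v _.
rewrite in_nb_next !inE; case: (e u v) => //=.
by case: (prev != Some v) => //; case: (c <= y v)%N.
Qed.

(* Each step finds a low vertex with probability at least 1/3, and
   [p/(z+1) + (1-p)/z <= 1/(z+p/2)] for [z >= 1]. *)
Lemma walk_mean_low y j prev u m (a : R) : 1 <= a ->
  (forall v, (#|[set x in neighbours e v | (j < y x)%N]%SET|).*2 <= d)%N ->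
  walk_mean e prev u m (fun q => (a + (count (fun v => y v <= j)%N q)%:R)^-1)
    <= (a + m%:R / 6)^-1.
Proof.
move=> + hlow; elim: m prev u a => [|m IH] prev u a a1.
  by rewrite walk_mean0 mul0r.
rewrite walk_meanS; set N := nb_next e prev u.
pose z := a + m%:R / 6.
have z1 : 1 <= z by rewrite /z -[leLHS]addr0 lerD // divr_ge0.
pose low v := (y v <= j)%N.
apply: (@le_trans _ _ (\sum_v unif R N v * (z^-1 - (low v)%:R * (z^-1 - (z + 1)^-1)))).
  apply: ler_sum => v _; apply: ler_wpM2l; first exact: unif_ge0.
  rewrite /= -/(low v); case: (low v).
    rewrite mul1r subKr /z addrAC; apply: le_trans (IH _ _ _ _); last by lra.
    by apply: ler_walk_mean => q _; rewrite natrD addrA.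
  by rewrite mul0r subr0; apply: IH.
under eq_bigr do rewrite mulrBr mulrA.
rewrite big_split /= sumrN -mulr_suml sum_unif1; last exact: (card_nb_next_gt0 e_reg d_gt1).
rewrite mul1r -mulr_suml sum_unif -natr_sum.
have -> : (\sum_(v in N) low v)%N = #|[set v in N | low v]%SET|.
  by rewrite -sum1dep_card big_mkcondr; apply: eq_bigr => v _; case: (low v).
set k := #|_|.
have N0 : (0 < #|N|)%N by apply: (card_nb_next_gt0 e_reg d_gt1).
(* At most [d / 2] of at least [d - 1] choices are high, and [3 (d / 2) <= 2 (d - 1)] for
   [d >= 4]. *)
have hk : (#|N| <= 3 * k)%N.
  have hN : #|N| = (k + #|[set x in N | (j < y x)%N]%SET|)%N.
    rewrite -(cardsID [set v | low v]%SET N); congr (_ + _)%N; apply: eq_card => v;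
      by rewrite !inE // -ltnNge andbC.
  have := card_nb_next_ge e_reg prev u; rewrite -/N.
  have := hlow u.
  have : (#|[set x in N | (j < y x)%N]%SET| <= #|[set x in neighbours e u | (j < y x)%N]%SET|)%N.
    by apply: subset_leq_card; apply/fintype.subsetP => x; rewrite !inE => /andP[/andP[-> _] ->].
  lia.
have p3 : 3^-1 <= k%:R / #|N|%:R :> R.
  rewrite ler_pdivlMr ?ltr0n // mulrC ler_pdivrMr // mulrC -natrM ler_nat //.
have -> : a + m.+1%:R / 6 = z + 6^-1.
  by rewrite /z -natr1 mulrDl mul1r addrA.
set p := _ / _ in p3 *.
have h : (z^-1 - (z + 1)^-1) * 3^-1 <= p * (z^-1 - (z + 1)^-1).
  rewrite mulrC ler_wpM2r // subr_ge0 lef_pV2 ?posrE; lra.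
rewrite lerBlDr -lerBlDl; apply: le_trans h.
have -> : z^-1 - (z + 6^-1)^-1 = 6^-1 / (z * (z + 6^-1)).
  by field; apply/andP; split; lra.
have -> : (z^-1 - (z + 1)^-1) / 3 = 3^-1 / (z * (z + 1)).
  by field; apply/andP; split; lra.
rewrite ler_pdivrMr; last by apply: mulr_gt0; lra.
rewrite mulrAC ler_pdivlMr; last by apply: mulr_gt0; lra.
nra.
Qed.

Lemma sum_ball (f : T -> seq T -> T -> R) :
  \sum_(b : Defs.ball T l) f b.1.1 b.1.2 b.2 = \sum_s \sum_(p : l.-tuple T) \sum_v f s p v.
Proof. by rewrite pair_bigA /= pair_bigA. Qed.

Lemma sum_ball_prob1 y : (0 < #|T|)%N ->
  \sum_(b : Defs.ball T l) ball_prob R e y b = 1.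
Proof.
move=> T0; rewrite (sum_ball (fun s p v => unif R [set: T] s * nbrw_prob R e None s p
  * unif R (least_loaded y (s :: p)) v)).
under eq_bigr => s _.
  under eq_bigr => p _.
    rewrite -mulr_sumr sum_unif1 ?mulr1; last first.
      pose i := [arg min_(i < s in s :: p) y i].
      apply/card_gt0P; exists i; rewrite inE /i.
      case: arg_minnP => [|j js jmin]; first by rewrite inE eqxx.
      by rewrite js; apply/allP.
    over.
  rewrite -mulr_sumr; over.
under eq_bigr => s _.
  have := walk_mean1 R e_reg d_gt1 None s l.
  rewrite /walk_mean /sumseq; under eq_bigr do rewrite mulr1.
  move=> ->; rewrite mulr1; over.
by rewrite sum_unif1 // cardsT.
Qed.

(** [G] bounds the chance that the final choice picks [w] from either side of the walk alone, as
    [hit_mean_le] requires; [1 / #|T|] is the weight of the uniform start. *)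
Lemma placed_le y w (P : bool) (G : seq T -> R) (kappa : R) :
  (forall a (b : seq T), (size a + size b)%N = l -> walk_prob R e (a ++ w :: b) != 0 ->
     P%:R * unif R (least_loaded y (a ++ w :: b)) w <= G b /\
     P%:R * unif R (least_loaded y (a ++ w :: b)) w <= G (rev a)) ->
  (forall prev m, (uphalf l <= m)%N -> walk_mean e prev w m G <= kappa) ->
  \sum_(b : Defs.ball T l) ball_prob R e y b * ((b.2 == w) && P)%:R
    <= l.+1%:R * kappa / #|T|%:R.
Proof.
move=> hG hk.
pose Phi x := P%:R * unif R (least_loaded y x) w.
have Phi0 x : 0 <= Phi x by rewrite mulr_ge0 ?unif_ge0.
have := hit_mean_le e_sym e_reg d_gt1 hG Phi0 hk.
rewrite sumseqS => h.
rewrite (sum_ball (fun s p v => unif R [set: T] s * nbrw_prob R e None s p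
  * unif R (least_loaded y (s :: p)) v * ((v == w) && P)%:R)).
rewrite -[leRHS]mulrC; apply: le_trans (ler_wpM2l _ h); last by rewrite invr_ge0.
rewrite mulr_sumr; apply: ler_sum => s _; rewrite mulr_sumr; apply: ler_sum => p _.
rewrite (bigD1 w) //= eqxx [X in _ + X]big1 => [|v /negbTE ->]; last by rewrite mulr0.
rewrite addr0 {1}/unif inE cardsT div1r /Phi.
rewrite -!mulrA ler_wpM2l ?invr_ge0 // ler_wpM2l ?nbrw_prob_ge0 //.
have [_|wp] := boolP (w \in s :: p).
  by rewrite mul1r /unif le_eqVlt; apply/orP; left; apply/eqP; ring.
by rewrite inE (negbTE wp) !mul0r.
Qed.

(** A least loaded [w] of load at least [c] forces this load on the whole walk, so [G] can be the
    indicator that one side is high. *)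
Lemma placed_high_le y c (eta : R) w : 0 <= eta <= 1 -> sparse y c eta ->
  \sum_(b : Defs.ball T l) ball_prob R e y b * ((b.2 == w) && (c <= y w)%N)%:R
    <= l.+1%:R * eta ^+ uphalf l / #|T|%:R.
Proof.
move=> /andP[eta0 eta1] sp.
apply: (placed_le (G := fun q => (all (fun v => (c <= y v)%N) q)%:R)).
  move=> a b _ _; have [cw|_] := leqP c (y w); last by rewrite mul0r.
  rewrite mul1r /unif; case: (boolP (w \in _)); last by rewrite mul0r.
  rewrite inE => /andP[_ /allP hw].
  have ha q : {subset q <= a ++ w :: b} -> all (fun v => (c <= y v)%N) q.
    by move=> qab; apply/allP => v /qab /hw /(leq_trans cw).
  have A1 : #|least_loaded y (a ++ w :: b)|%:R^-1 <= 1 :> R.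
    case: (#|_|) => [|k]; first by rewrite invr0.
    by rewrite invf_le1 ?ltr0n // ler1n.
  by split; rewrite mul1r ha // => v vb;
    rewrite mem_cat ?inE ?vb ?orbT // -mem_rev vb.
move=> prev m lm; apply: le_trans (walk_mean_high _ _ _ _ sp) _ => //.
by rewrite ler_wiXn2l.
Qed.

(* When the ball is placed on [w] with [j <= y w], the vertices of load at most
   [j] on its walk are least loaded, and they are distinct, so that the final
   uniform choice picks [w] with probability at most [2 / (1 + their number)]. *)
Lemma placed_low_le y j w :
  (forall v, (#|[set x in neighbours e v | (j < y x)%N]%SET|).*2 <= d)%N ->
  \sum_(b : Defs.ball T l) ball_prob R e y b * ((b.2 == w) && (j <= y w)%N)%:R
    <= 24 / #|T|%:R.
Proof.
move=> hlow.
(* The [l + 1] positions cancel against the decay in [l]: [2 (l + 1) / (1 + l / 12) <= 24]. *)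
apply: (@le_trans _ _ (l.+1%:R * (2 * (1 + (uphalf l)%:R / 6)^-1) / #|T|%:R)); last first.
  rewrite ler_wpM2r ?invr_ge0 //.
  have : (l <= (uphalf l).*2)%N by rewrite -leq_uphalf_double.
  rewrite -(ler_nat R) -muln2 natrM => h.
  rewrite mulrA ler_pdivrMr -?[l.+1%:R]natr1; last by rewrite ltr_wpDr // divr_ge0.
  by move: h; set L := l%:R; set U := (uphalf l)%:R; lra.
apply: (placed_le (G := fun q => 2 * (1 + (count (fun v => (y v <= j)%N) q)%:R)^-1)).
  move=> a b sab /(walk_uniq e_irr e_reg d_gt1 girth_l) uab.
  have {}uab : uniq (a ++ w :: b) by apply: uab; rewrite size_cat /= addnS sab.
  set x := a ++ w :: b in uab *.
  have [jw|_] := leqP j (y w); last by rewrite mul0r; split; rewrite mulr_ge0 ?invr_ge0 ?addr_ge0.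
  rewrite mul1r /unif; case: (boolP (w \in _)); last first.
    by rewrite mul0r; split; rewrite mulr_ge0 ?invr_ge0 ?addr_ge0.
  move=> wL; have L0 : (0 < #|least_loaded y x|)%N by apply/card_gt0P; exists w.
  move: (wL); rewrite inE => /andP[_ /allP hw].
  rewrite mul1r.
  have hq q : {subset q <= x} -> uniq q ->
      #|least_loaded y x|%:R^-1 <= 2 * (1 + (count (fun v => (y v <= j)%N) q)%:R)^-1 :> R.
    move=> qx uq; set k := count _ _.
    rewrite ler_pdivlMr ?ltr_wpDr // mulrC ler_pdivrMr ?ltr0n // nat1r -natrM ler_nat.
    (* As [1 <= #|least_loaded y x|] too, [1 + k] is at most twice this cardinal, whence the factor
       2. *)
    suff : (k <= #|least_loaded y x|)%N by lia.
    rewrite /k -size_filter -(card_uniqP (filter_uniq _ uq)).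
    apply: subset_leq_card; apply/fintype.subsetP => v.
    rewrite mem_filter inE => /andP[vj vq]; rewrite qx //=; apply/allP => z zx.
    by apply: leq_trans vj (leq_trans jw (hw _ zx)).
  move: (uab); rewrite cat_uniq /= => /and3P[ua _ /andP[_ ub]].
  split; apply: hq => //; rewrite ?rev_uniq // => v vb;
    by rewrite mem_cat ?inE ?vb ?orbT // -mem_rev vb.
move=> prev m lm; rewrite (_ : walk_mean _ _ _ _ _ = 2 * walk_mean e prev w m
    (fun q => (1 + (count (fun v => y v <= j)%N q)%:R)^-1)).
  rewrite ler_wpM2l //; apply: le_trans (walk_mean_low _ _ _ _ hlow) _ => //.
  rewrite lef_pV2 ?posrE ?ltr_wpDr ?divr_ge0 //.
  by rewrite lerD2l ler_wpM2r // ler_nat.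
by rewrite /walk_mean -sumseqZ; apply: eq_sumseq => q _; rewrite mulrCA.
Qed.

Lemma placed_in_le y (Z : {set T}) (P : pred nat) (kappa : R) :
  (forall w, \sum_(b : Defs.ball T l) ball_prob R e y b * ((b.2 == w) && P (y w))%:R
     <= kappa) ->
  \sum_(b : Defs.ball T l) ball_prob R e y b * ((b.2 \in Z) && P (y b.2))%:R
    <= #|Z|%:R * kappa.
Proof.
move=> h; apply: (@le_trans _ _ (\sum_(w in Z) kappa)); last first.
  by rewrite mulr_natl sumr_const.
apply: le_trans (ler_sum _ (fun w _ => h w)).
rewrite exchange_big /=; apply: ler_sum => b _; rewrite -mulr_sumr.
apply: ler_wpM2l; first exact: ball_prob_ge0.
have [bZ|_] := boolP (b.2 \in Z); last by apply: sumr_ge0.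
by rewrite (bigD1 b.2) //= eqxx lerDl sumr_ge0.
Qed.

End Placement.

(** * Propagation of sparsity *)

Lemma card_fibres (I T : finType) (A : {set I}) (f : I -> T) (V : {set T}) (k : nat) :
  (forall x, x \in V -> (k <= #|[set s in A | f s == x]%SET|)%N) ->
  (#|V| * k <= #|A|)%N.
Proof.
move=> h; rewrite -sum_nat_const -[leqRHS]sum1_card.
rewrite (bigID (fun s => f s \in V)) /= (partition_big f (mem V)) /=; last first.
  by move=> s /andP[].
apply: leq_trans (leq_addr _ _); apply: leq_sum => x xV.
apply: leq_trans (h x xV) _; rewrite -sum1_card; apply/eq_leq/eq_bigl => s.
by rewrite !inE; case: eqP => [->|]; rewrite ?xV ?andbT ?andbF.
Qed.

(** * Loads along a history *)

Section Loads.
Variables (T : finType) (m l : nat).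
Implicit Types (w : history T m l).

Lemma loadS w (t : 'I_m) v : load w t.+1 v = (load w t v + ((w t).2 == v))%N.
Proof.
rewrite /load (cardsD1 t) inE ltnSn /= addnC; congr (_ + _)%N.
by apply: eq_card => s; rewrite !inE ltnS ltn_neqAle -val_eqE andbA.
Qed.

Lemma load_mono w k k' v : (k <= k')%N -> (load w k v <= load w k' v)%N.
Proof.
move=> kk'; apply: subset_leq_card; apply/fintype.subsetP => s; rewrite !inE.
by case/andP => sk ->; rewrite (leq_trans sk).
Qed.

(** A ball that lifts [v] above load [c] finds it at load at least [c], so at most [c] balls on [v]
    escape the count. *)
Lemma load_le_count w c k v : (k <= m)%N ->
  (load w k v <=
   c + #|[set s : 'I_m | [&& (s < k)%N, (w s).2 == v & (c <= load w s v)%N]]%SET|)%N.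
Proof.
elim: k => [|k IH] km.
  by apply: leq_trans (leq0n _); rewrite leqn0 cards_eq0; apply/eqP/setP => s; rewrite !inE.
have := IH (ltnW km); rewrite (loadS w (Ordinal km)) /=.
set A := [set s | _]%SET; set A' := [set s | _]%SET => h.
have AA' : A \subset A'.
  apply/fintype.subsetP => s; rewrite !inE => /and3P[sk -> ->].
  by rewrite ltnW.
have [wv|wv] := eqVneq; last by rewrite addn0; apply: leq_trans h _; rewrite leq_add2l subset_leq_card.
have [lc|cl] := ltnP (load w k v) c.
  by rewrite addn1; apply: leq_trans lc (leq_addr _ _).
have : (Ordinal km |: A)%SET \subset A'.
  by rewrite finset.subUset AA' andbT finset.sub1set inE /= ltnSn wv eqxx.
move/subset_leq_card; rewrite cardsU1 inE ltnn /=; lia.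
Qed.

Lemma placed_of_load w c k v : (k <= m)%N -> (c < load w k v)%N ->
  exists2 s : 'I_m, (s < k)%N & (w s).2 = v /\ (c <= load w s v)%N.
Proof.
move=> km cv; have := load_le_count w c v km.
set A := [set s | _]%SET => h; have : (0 < #|A|)%N by lia.
by case/card_gt0P => s; rewrite inE => /and3P[sk /eqP sv cs]; exists s.
Qed.

End Loads.

(** * Chernoff bounds for sparsity and the maximum load *)

Section Stages.
Variables (R : realType) (T : finType) (e : rel T) (d l m : nat).
Hypotheses (e_sym : symmetric e) (e_irr : irreflexive e) (e_reg : regular e d).
Hypothesis d_gt3 : (3 < d)%N.
Hypothesis girth_l : forall c : seq T, (2 < size c)%N -> ucycle e c -> (l < size c)%N.
Hypotheses (m_card : #|T| = m) (m_gt0 : (0 < m)%N).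

Local Notation Pr := (alloc_prob R e m l).

Let T_gt0 : (0 < #|T|)%N. Proof. by rewrite m_card. Qed.
Let m0 : m%:R != 0 :> R. Proof. by rewrite pnatr_eq0 -lt0n. Qed.

Let b0 : Defs.ball T l.
Proof.
have [s _|T0] := pickP (predT : pred T); first exact: ((s, [tuple of nseq l s]), s).
by exfalso; move: T_gt0; rewrite eq_card0.
Qed.

Let b1 y : \sum_(b : Defs.ball T l) ball_prob R e y b <= 1.
Proof. by rewrite (sum_ball_prob1 R l e_reg d_gt3 y T_gt0). Qed.

Lemma sum_history_prob1 : \sum_(w : history T m l) history_prob R e w = 1.
Proof. by apply: sum_history_prob => // y; exact: (sum_ball_prob1 R l e_reg d_gt3). Qed.

(** Loads only grow, so sparsity at the end can be assumed at the arrival of each ball. *)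
Lemma sparse_mono (w : history T m l) c eta k : (k <= m)%N ->
  sparse e d (load w m) c eta -> sparse e d (load w k) c (eta : R).
Proof.
move=> km /forallP h; apply/forallP => u; apply: le_trans (h u); rewrite ler_nat.
apply: subset_leq_card; apply/fintype.subsetP => v; rewrite !inE => /andP[-> /=].
by move/leq_trans; apply; apply: load_mono.
Qed.

(** A vertex of load above [c] received a ball of height at least [c]. While level [c] is sparse,
    the mean number of such balls in a neighbourhood is at most [d (l + 1) eta ^ uphalf l];
    Chernoff's bound with [x = 1] and a union over the [m] neighbourhoods conclude. *)
Lemma sparse_step c (eta eta' : R) : 0 <= eta <= 1 ->
  expR 1 * (d%:R * (l.+1%:R * eta ^+ uphalf l)) <= eta' * d.-1%:R / 2 ->
  Pr (fun w => ~~ sparse e d (load w m) c.+1 eta')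
    <= Pr (fun w => ~~ sparse e d (load w m) c eta)
       + m%:R * expR (- (eta' * d.-1%:R / 2)).
Proof.
move=> eta01 hmu; pose q := eta' * d.-1%:R.
(* Sparsity is part of the event, so that its conditional probability is bounded for every past. *)
pose a u (t : 'I_m) (y : T -> nat) (b : Defs.ball T l) :=
  sparse e d y c eta && ((b.2 \in neighbours e u) && (c <= y b.2)%N).
pose E u (w : history T m l) := q <= #|[set t | a u t (load w t) (w t)]%SET|%:R.
apply: (@le_trans _ _ (Pr (predU (fun w => ~~ sparse e d (load w m) c eta)
    (fun w => [exists u in T, E u w])))).
  apply: alloc_prob_le => w _; rewrite /in_mem /= => nS.
  have [Sw|//] := boolP (sparse e d (load w m) c eta).
  move: nS; rewrite negb_forall => /existsP[u]; rewrite -ltNge -/q => hu.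
  apply/existsP; exists u; rewrite /=; apply: le_trans (ltW hu) _.
  rewrite ler_nat; apply: leq_trans (leq_imset_card (fun t => (w t).2) _).
  apply: subset_leq_card; apply/fintype.subsetP => v; rewrite inE => /andP[uv cv].
  have [s _ [sv cs]] := placed_of_load (leqnn m) cv.
  apply/imsetP; exists s => //; rewrite inE /a sv uv cs.
  by rewrite (sparse_mono _ Sw) // ltnW.
apply: le_trans (@alloc_probU R T e m l _ _) _; rewrite lerD2l.
apply: le_trans (@alloc_prob_bigU R T e m l _ _ _) _.
apply: (@le_trans _ _ (\sum_(u in T) expR (- (q / 2)))); last first.
  by rewrite sumr_const m_card mulr_natl.
apply: ler_sum => u _.
pose p : R := d%:R * (l.+1%:R * eta ^+ uphalf l / m%:R).
have /andP[eta0 _] := eta01.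
have p0 : 0 <= p by rewrite !mulr_ge0 ?invr_ge0 ?exprn_ge0.
apply: le_trans (@alloc_tail R T e m l b0 (a u) (fun=> p) 1 q ler01 b1 _) _.
  move=> t y; rewrite /a; have [Sy|_] := boolP (sparse e d y c eta); last first.
    by rewrite big1 // => b _; rewrite mulr0.
  rewrite /p -(e_reg u); apply: (@placed_in_le _ _ e l y _ (fun k => (c <= k)%N)) => w.
  by rewrite -m_card; apply: (placed_high_le l e_sym e_reg d_gt3).
rewrite ler_expR sumr_const card_ord mul1r.
have -> : p *+ m = d%:R * (l.+1%:R * eta ^+ uphalf l).
  by rewrite /p -mulr_natl; field.
rewrite /q; lra.
Qed.


(** A step has at most [d] choices. As the probabilities sum to one, there are at most [d ^ l] walks
    of length [l] from a vertex. *)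
Lemma walk_prob_ge (s : T) (p : seq T) :
  nbrw_prob R e None s p != 0 -> d%:R ^- size p <= nbrw_prob R e None s p.
Proof.
elim: p None s => [|v p IH] prev s /=; first by rewrite expr0 invr1.
rewrite mulf_eq0 negb_or => /andP[h /IH hp].
rewrite exprS invfM; apply: ler_pM => //; rewrite ?invr_ge0 ?exprn_ge0 //.
move: h => /unif_supp h; rewrite /unif h div1r lef_pV2 ?posrE ?ltr0n.
- rewrite ler_nat -(e_reg s); apply: subset_leq_card; apply/fintype.subsetP => x.
  by rewrite !inE => /andP[].
- by apply: leq_trans d_gt3.
- by apply/card_gt0P; exists v.
Qed.

(* A ball of height [c + k] has a walk whose [l + 1] vertices have each received
   [k] balls of height at least [c]; there are at most [m * d ^ l] walks. *)
Lemma max_load_le c (eta : R) k x : 0 <= eta <= 1 -> 0 <= x ->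
  Pr (fun w => (c + k < max_load w)%N)
    <= Pr (fun w => ~~ sparse e d (load w m) c eta)
       + m%:R * d%:R ^+ l
         * expR (expR x * (l.+1%:R ^+ 2 * eta ^+ uphalf l) - x * (k * l.+1)%:R).
Proof.
move=> eta01 x0.
pose Z (sp : T * l.-tuple T) := [set z | z \in sp.1 :: sp.2]%SET.
pose a sp (t : 'I_m) (y : T -> nat) (b : Defs.ball T l) :=
  sparse e d y c eta && ((b.2 \in Z sp) && (c <= y b.2)%N).
pose E sp (w : history T m l) :=
  (k * l.+1)%:R <= #|[set t | a sp t (load w t) (w t)]%SET|%:R :> R.
pose D : pred (T * l.-tuple T) := fun sp => nbrw_prob R e None sp.1 sp.2 != 0.
apply: (@le_trans _ _ (Pr (predU (fun w => ~~ sparse e d (load w m) c eta)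
    (fun w => [exists sp in D, E sp w])))).
  apply: alloc_prob_le => w hw; rewrite /in_mem /= => ckw.
  have [Sw|//] := boolP (sparse e d (load w m) c eta).
  have [v cv] : exists v, (c + k < load w m v)%N.
    apply/existsP; apply: contraTT ckw; rewrite negb_exists -leqNgt => /forallP h.
    by apply/bigmax_leqP => v _; rewrite leqNgt.
  have [s _ [sv cs]] := placed_of_load (leqnn m) cv.
  have : ball_prob R e (load w s) (w s) != 0.
    by move: hw; rewrite /history_prob => /prodf_neq0; apply.
  rewrite /ball_prob mulf_eq0 negb_or => /andP[+ /unif_supp].
  rewrite mulf_eq0 negb_or => /andP[_ Dw]; rewrite inE => /andP[_ /allP hleast].
  apply/existsP; exists (w s).1; rewrite [X in X && _]Dw /= /E ler_nat.
  (* The girth makes the [l + 1] vertices distinct, so their balls add up to at least [k * l.+1]. *)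
  have -> : l.+1 = #|Z (w s).1|.
    rewrite cardsE; have /card_uniqP -> : uniq ((w s).1.1 :: (w s).1.2).
      by apply: (@walk_uniq R _ _ _ e_irr e_reg (ltnW (ltnW d_gt3)) l _ girth_l);
        rewrite //= size_tuple.
    by rewrite /= size_tuple.
  rewrite mulnC; apply: (@card_fibres _ _ _ (fun t => (w t).2)) => z zZ.
  have hz : (c + k <= load w m z)%N.
    apply: leq_trans (load_mono w z (ltnW (ltn_ord s))).
    by apply: leq_trans cs _; rewrite sv in hleast *; apply: hleast; rewrite inE in zZ.
  have := load_le_count w c z (leqnn m); set A := [set t | [&& _, _ & _]]%SET => hA.
  apply: (@leq_trans #|A|); first by rewrite -(leq_add2l c); apply: leq_trans hz hA.
  apply: subset_leq_card; apply/fintype.subsetP => t; rewrite !inE => /and3P[_ /eqP tz ct].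
  by rewrite tz eqxx andbT /a tz zZ ct (sparse_mono _ Sw) // ltnW.
apply: le_trans (@alloc_probU R T e m l _ _) _; rewrite lerD2l.
apply: le_trans (@alloc_prob_bigU R T e m l _ _ _) _.
set K := expR _.
apply: (@le_trans _ _ (\sum_(sp in D) K)); last first.
  rewrite sumr_const -[leLHS]mulr_natl ler_wpM2r ?expR_ge0 //.
  rewrite -sum1_card natr_sum.
  apply: (@le_trans _ _ (\sum_(sp : T * l.-tuple T)
      d%:R ^+ l * nbrw_prob R e None sp.1 sp.2)).
    rewrite big_mkcond; apply: ler_sum => -[s p] _ /=.
    case: ifP => [/walk_prob_ge|_]; last by rewrite mulr_ge0 ?exprn_ge0 ?nbrw_prob_ge0.
    rewrite size_tuple /= => h.
    by rewrite -ler_pdivrMl ?mulr1 // exprn_gt0 // ltr0n (leq_trans _ d_gt3).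
  rewrite -mulr_sumr mulrC ler_wpM2r ?exprn_ge0 //.
  rewrite -(pair_bigA _ (fun s (p : l.-tuple T) => nbrw_prob R e None s p)) /=.
  apply: (@le_trans _ _ (\sum_(s : T) 1)); last by rewrite sumr_const m_card.
  apply: ler_sum => s _.
  rewrite -(walk_mean1 R e_reg (ltnW (ltnW d_gt3)) None s l) /walk_mean /sumseq.
  by under [leRHS]eq_bigr do rewrite mulr1.
apply: ler_sum => sp _.
have /andP[eta0 _] := eta01.
pose p : R := l.+1%:R * (l.+1%:R * eta ^+ uphalf l / m%:R).
have p0 : 0 <= p by rewrite !mulr_ge0 ?invr_ge0 ?exprn_ge0.
apply: le_trans (@alloc_tail R T e m l b0 (a sp) (fun=> p) x _ x0 b1 _) _.
  move=> t y; rewrite /a; have [Sy|_] := boolP (sparse e d y c eta); last first.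
    by rewrite big1 // => b _; rewrite mulr0.
  apply: (@le_trans _ _ (#|Z sp|%:R * (l.+1%:R * eta ^+ uphalf l / m%:R))).
    apply: (@placed_in_le _ _ e l y _ (fun k => (c <= k)%N)) => w.
    by rewrite -m_card; apply: (placed_high_le l e_sym e_reg d_gt3).
  rewrite ler_wpM2r ?mulr_ge0 ?invr_ge0 ?exprn_ge0 // ler_nat cardsE.
  by apply: leq_trans (card_size _) _; rewrite /= size_tuple.
rewrite ler_expR lerD2r ler_wpM2l ?expR_ge0 // sumr_const card_ord.
by rewrite le_eqVlt /p -mulr_natl; apply/orP; left; apply/eqP; field.
Qed.

(** * The constant level, by batches *)

Section Base.
Variable C : nat.
Hypotheses (C_gt0 : (0 < C)%N) (C_le_m : (C <= m)%N).

Let B := (m %/ C).+1.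

Let low r (y : T -> nat) :=
  [forall v, (#|[set x in neighbours e v | (C * r < y x)%N]%SET|).*2 <= d]%N.

(* The balls arrive in [C] batches of length [B]; ball [t] is relevant when it
   raises a vertex whose load is at least [C] times the index of its batch. *)
Let relevant u (t : nat) (y : T -> nat) (b : Defs.ball T l) :=
  low (t %/ B) y && ((b.2 \in neighbours e u) && (C * (t %/ B) <= y b.2)%N).

Let batch u r (w : history T m l) :=
  [set t : 'I_m | (t %/ B == r)%N && relevant u t (load w t) (w t)]%SET.

Let ltmCB : (m < C * B)%N.
Proof. by rewrite /B mulnC -ltn_divLR. Qed.

(** Let [r] be the batch of [k]. A neighbour of [u] above [C * r] either received a relevant ball in
    batch [r], or reached [C * r] in an earlier batch; then [C] relevant balls lifted it from
    [C * (r - 1)]. Each kind accounts for at most [d / 4] neighbours, the second because all batches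
    together hold at most [C d / 4] relevant balls. *)
Let batch_small_low w :
  (forall u r, (r < C)%N -> (4 * #|batch u r w| <= d)%N) ->
  forall k, (k <= m)%N -> low (k %/ B) (load w k).
Proof.
move=> hb; elim/ltn_ind => k IH km; apply/forallP => u.
set r := (k %/ B)%N; set X := [set x in _ | _]%SET.
have divC (s : 'I_m) : (s %/ B < C)%N.
  by rewrite ltn_divLR //; apply: ltn_trans (ltn_ord s) ltmCB.
pose A := [set t : 'I_m | relevant u t (load w t) (w t)]%SET.
pose V := [set x | C <= #|[set t in A | (w t).2 == x]%SET|]%N%SET.
have hA : (4 * #|A| <= C * d)%N.
  rewrite -[C in (_ <= C * _)%N]card_ord -sum_nat_const -sum1_card.
  rewrite (partition_big (fun t : 'I_m => Ordinal (divC t)) predT) //= big_distrr /=.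
  apply: leq_sum => -[i iC] _; apply: leq_trans (hb u i iC).
  rewrite leq_mul2l /= -sum1_card; apply/eq_leq/eq_bigl => t.
  by rewrite !inE andbC -val_eqE.
have hV : (#|V| * C <= #|A|)%N by apply: (@card_fibres _ _ _ (fun t => (w t).2)) => x; rewrite inE.
have XV : X \subset ((fun t => (w t).2) @: batch u r w :|: V)%SET.
  apply/fintype.subsetP => x; rewrite !inE => /andP[ux rx].
  have [s sk [sx rs]] := placed_of_load km rx.
  have lows (t : 'I_m) : (t < k)%N -> low (t %/ B) (load w t) by move=> tk; apply: IH => //; apply: ltnW.
  have sr : (s %/ B <= r)%N by apply: leq_div2r; apply: ltnW.
  have [sr_eq|sr_ne] := eqVneq (s %/ B)%N r.
    apply/orP; left; apply/imsetP; exists s => //.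
    by rewrite inE sr_eq eqxx /relevant sr_eq -sr_eq lows // sx inE ux sr_eq.
  have {}sr : (s %/ B < r)%N by rewrite ltn_neqAle sr_ne.
  have r0 : (0 < r)%N by apply: leq_trans sr.
  apply/orP; right.
  have := load_le_count w (C * r.-1) x (ltnW (ltn_ord s)).
  set S := [set t | [&& _, _ & _]]%SET => hS.
  have CS : (C <= #|S|)%N.
    have : (C * r = C * r.-1 + C)%N by rewrite -mulnSr prednK.
    by lia.
  apply: leq_trans CS _; apply: subset_leq_card; apply/fintype.subsetP => t.
  rewrite !inE => /and3P[ts /eqP tx rt]; rewrite tx eqxx andbT /relevant tx inE ux.
  rewrite lows ?(ltn_trans ts) //=; apply: leq_trans rt; rewrite leq_mul2l.
  apply/orP; right; rewrite -ltnS prednK //.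
  by apply: leq_ltn_trans sr; apply: leq_div2r; apply: ltnW.
have := leq_trans (subset_leq_card XV) (leq_card_setU _ _).
have := leq_imset_card (fun t => (w t).2) (batch u r w).
have hr : (4 * #|batch u r w| <= d)%N.
  have [rC|Cr] := ltnP r C; first exact: hb.
  rewrite [batch u r w](_ : _ = finset.set0) ?cards0 //.
  apply/setP => t; rewrite !inE; case: eqP => // tr.
  by move: (divC t); rewrite tr ltnNge Cr.
have hV4 : (4 * #|V| <= d)%N.
  by rewrite -(leq_pmul2r C_gt0) -mulnA (leq_trans _ (leq_trans hA _)) ?leq_mul2l // mulnC.
set i := #|_|; set b := #|batch u r w| in hr *; set V' := #|V| in hV4 *; set X' := #|X|.
lia.
Qed.

Let card_batch r : (#|[set t : 'I_m | t %/ B == r]%N%SET| <= B)%N.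
Proof.
rewrite -[B in (_ <= B)%N]card_ord.
pose f (t : 'I_m) : 'I_B := inord (t %% B).
apply: leq_trans (max_card (f @: [set t : 'I_m | t %/ B == r]%N%SET)).
rewrite card_in_imset // => s t; rewrite !inE => /eqP sr /eqP tr /(congr1 val).
rewrite /f /= !inordK ?ltn_mod // => st; apply: val_inj => /=.
by rewrite (divn_eq s B) (divn_eq t B) sr tr st.
Qed.

(** A batch has at most [2 m / C] balls, each relevant to a given vertex with probability at most
    [24 d / m]. As [384 e <= C], [e] times the mean [48 d / C] is at most [d / 8], half of the
    target [d / 4]. *)
Lemma sparse_base (eta : R) : 384 * expR 1 <= C%:R :> R ->
  d%:R / 2 <= eta * d.-1%:R ->
  Pr (fun w => ~~ sparse e d (load w m) (C * C).+1 eta)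
    <= m%:R * C%:R * expR (- (d%:R / 8)).
Proof.
move=> hC heta.
pose a u r (t : 'I_m) (y : T -> nat) (b : Defs.ball T l) :=
  (t %/ B == r)%N && relevant u t y b.
pose E (ur : T * 'I_C) (w : history T m l) :=
  d%:R / 4 <= #|[set t | a ur.1 ur.2 t (load w t) (w t)]%SET|%:R :> R.
apply: (@le_trans _ _ (Pr (fun w => [exists ur in predT, E ur w]))).
  apply: alloc_prob_le => w _; apply: contraNT; rewrite negb_exists => /forallP nE.
  have /batch_small_low /(_ m (leqnn m)) /forallP lowm : forall u r,
      (r < C)%N -> (4 * #|batch u r w| <= d)%N.
    move=> u r rC; have := nE (u, Ordinal rC); rewrite /= -ltNge.
    rewrite ltr_pdivlMr // -natrM ltr_nat mulnC; exact: ltnW.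
  apply/forallP => u; apply: le_trans heta.
  rewrite ler_pdivlMr // -natrM ler_nat muln2; apply: leq_trans (lowm u).
  rewrite leq_double; apply: subset_leq_card; apply/fintype.subsetP => x.
  rewrite !inE => /andP[-> /=]; apply: leq_trans.
  (* The batch index [m %/ B] is below [C], so the last threshold is at most [C * C]. *)
  by rewrite ltnS leq_mul2l -ltnS ltn_divLR // mulSnr ltn_addr ?orbT.
apply: le_trans (@alloc_prob_bigU R T e m l _ _ _) _.
apply: (@le_trans _ _ (\sum_(ur in predT : pred (T * 'I_C)) expR (- (d%:R / 8)))); last first.
  rewrite sumr_const (_ : #|_| = (m * C)%N).
    by rewrite -[leLHS]mulr_natl natrM.
  by rewrite -m_card -[X in (_ = _ * X)%N](card_ord C) -card_prod; apply: eq_card.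
apply: ler_sum => -[u r] _.
pose p (t : 'I_m) : R := (t %/ B == r)%N%:R * (d%:R * (24 / m%:R)).
have p0 : 0 <= d%:R * (24 / m%:R) :> R by rewrite !mulr_ge0 ?invr_ge0.
apply: le_trans (@alloc_tail R T e m l b0 (a u r) p 1 (d%:R / 4) ler01 b1 _) _.
  move=> t y; rewrite /a /p /relevant.
  have [tr|_] := eqVneq (t %/ B)%N r; last first.
    by rewrite mul0r big1 // => b _; rewrite mulr0.
  have [/forallP Ly|_] := boolP (low _ y); last first.
    by rewrite mul1r big1 // => b _; rewrite mulr0.
  rewrite mul1r /= -(e_reg u).
  apply: (@placed_in_le _ _ e l y _ (fun k => (C * (t %/ B) <= k)%N)) => w.
  have := placed_low_le R e_sym e_irr e_reg d_gt3 girth_l w Ly.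
  by rewrite m_card.
rewrite ler_expR mul1r.
have hp : \sum_t p t <= B%:R * (d%:R * (24 / m%:R)).
  rewrite -mulr_suml ler_wpM2r // -natr_sum ler_nat.
  apply: leq_trans (card_batch r); rewrite -sum1_card [leqRHS]big_mkcond /=.
  by apply: leq_sum => t _; rewrite inE; case: (_ == _).
have hB : B%:R * C%:R <= 2 * m%:R :> R.
  rewrite -!natrM ler_nat /B mulSn mul2n -addnn leq_add //.
  exact: leq_divM.
have e0 : 0 < expR 1 :> R by apply: expR_gt0.
have hBm : B%:R * (d%:R * (24 / m%:R)) * C%:R <= 48 * d%:R :> R.
  have -> : B%:R * (d%:R * (24 / m%:R)) * C%:R = (B%:R * C%:R) * d%:R * 24 / m%:R :> R by ring.
  rewrite ler_pdivrMr ?ltr0n //.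
  have : B%:R * C%:R * d%:R <= 2 * m%:R * d%:R :> R by rewrite ler_wpM2r.
  lra.
have : expR 1 * \sum_t p t <= d%:R / 8.
  apply: le_trans (ler_wpM2l (ltW e0) hp) _.
  set x := B%:R * _ in hBm *.
  have x0 : 0 <= x by rewrite mulr_ge0.
  have : (384 * expR 1) * x <= C%:R * x by rewrite ler_wpM2r.
  lra.
lra.
Qed.

End Base.

End Stages.

(** * The maximum load on a fixed graph *)

Section FixedGraph.
Variables (R : realType) (T : finType) (e : rel T) (d l m C : nat).
Hypotheses (e_sym : symmetric e) (e_irr : irreflexive e) (e_reg : regular e d).
Hypothesis d_gt3 : (3 < d)%N.
Hypothesis girth_l : forall c : seq T, (2 < size c)%N -> ucycle e c -> (l < size c)%N.
Hypotheses (m_card : #|T| = m) (C_le_m : (C <= m)%N).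
Hypothesis C_large : 384 * expR 1 <= C%:R :> R.
Hypothesis d_large : 40 * ln m%:R <= d%:R :> R.
Hypothesis lnd_ge1 : 1 <= ln d%:R :> R.
Hypothesis l_lnd : l%:R * ln d%:R <= ln m%:R :> R.
Hypothesis l_gt3 : (3 < l)%N.
Hypothesis l_large1 : 4 * expR 1 * l.+1%:R <= expR (l%:R / 16) :> R.
Hypothesis l_large2 : l.+1%:R ^+ 2 <= expR (l%:R / 16) :> R.

Local Notation Pr := (alloc_prob R e m l).
Local Notation L := (ln d%:R : R).
Local Notation N := (ln m%:R : R).

(* In layer [j] the fraction of loaded neighbours is [expR (- layer_exp j)]. *)
Definition layer_exp j : R := Num.min ((l%:R / 4) ^+ j) L / 4.

Let e1 : 1 < expR 1 :> R. Proof. by rewrite expR_gt1. Qed.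

Let C_gt384 : (384 < C)%N.
Proof. by rewrite -(ltr_nat R); move: C_large e1; lra. Qed.

Let m_gt384 : (384 < m)%N. Proof. exact: leq_trans C_le_m. Qed.

Let mR : 384 < m%:R :> R. Proof. by rewrite ltr_nat. Qed.

Let expN : expR N = m%:R. Proof. by rewrite lnK // posrE; move: mR; lra. Qed.

Let expL : expR L = d%:R.
Proof. by rewrite lnK // posrE ltr0n (leq_trans _ d_gt3). Qed.

Let r_ge1 : 1 <= l%:R / 4 :> R.
Proof. by rewrite ler_pdivlMr // mul1r ler_nat. Qed.

Let layer_exp0 : layer_exp 0 = 1 / 4.
Proof. by rewrite /layer_exp expr0 (min_idPl _). Qed.

Lemma layer_exp_ge j : 1 / 4 <= layer_exp j.
Proof. by rewrite /layer_exp ler_pM2r ?invr_gt0 // le_min exprn_ege1. Qed.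

Lemma layer_exp_le j : layer_exp j <= L / 4.
Proof. by rewrite /layer_exp ler_pM2r ?invr_gt0 // ge_min lexx orbT. Qed.

Lemma layer_expS j : layer_exp j.+1 <= l%:R / 4 * layer_exp j.
Proof.
rewrite /layer_exp mulrA ler_pM2r ?invr_gt0 //.
rewrite minr_pMr; last by apply: le_trans r_ge1.
rewrite le_min exprS ge_min lexx /= ge_min; apply/orP; right.
by rewrite ler_peMl //; move: lnd_ge1; lra.
Qed.

Let m_expR k : m%:R ^- k = expR (- (k%:R * N)) :> R.
Proof. by rewrite expRN expRM_natl expN. Qed.

Let expR_pow j : expR (- layer_exp j) ^+ uphalf l <= expR (- (layer_exp j * l%:R / 2)).
Proof.
rewrite -expRM_natl ler_expR mulrN lerN2 -mulrA [leRHS]mulrC.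
apply: ler_wpM2l; first by move: (layer_exp_ge j); lra.
by rewrite ler_pdivrMr // -natrM ler_nat muln2 -leq_uphalf_double.
Qed.

Let l16 j : l%:R / 16 <= l%:R * layer_exp j / 4.
Proof.
have := layer_exp_ge j; have : 0 <= l%:R :> R by [].
set x := l%:R; set t := layer_exp j; nra.
Qed.

(** As [layer_exp J >= 1 / 4], the factor [4 e (l + 1) <= expR (l / 16)] costs at most half of the
    exponent [layer_exp J * l / 2]; the other half covers [layer_exp J.+1]. The condition on [d]
    makes each new layer fail with probability at most [m ^- 4], and is void when [J = 0]. *)
Lemma sparse_layers J :
  (0 < J)%N ==> (10 * N <= expR (- (L / 4)) * d.-1%:R) ->
  Pr (fun w => ~~ sparse e d (load w m) ((C * C).+1 + J) (expR (- layer_exp J)))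
    <= J.+1%:R * m%:R ^- 3.
Proof.
have d1 : d%:R <= 2 * d.-1%:R :> R by rewrite -natrM ler_nat leq_double_pred // (leq_trans _ d_gt3).
have m_gt0 : (0 < m)%N by apply: leq_trans m_gt384.
elim: J => [|J IH] hJ.
  rewrite addn0 layer_exp0.
  apply: le_trans (sparse_base e_sym e_irr e_reg d_gt3 girth_l m_card m_gt0 _ C_le_m C_large _) _.
  - exact: leq_trans C_gt384.
  (* [expR (- 1 / 4) >= 3 / 4], and [d / 2 <= 3 / 4 * (d - 1)] as [d >= 4]. *)
  - have := expR_ge1Dx (- (1 / 4 : R)); set x := expR _ => hx.
    have : (3 <= d.-1)%N by move: d_gt3; case: d.
    rewrite -(ler_nat R) => h3; have -> : d%:R = d.-1%:R + 1 :> R.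
      by rewrite natr1 prednK // (leq_trans _ d_gt3).
    have : 0 <= (x - 3/4) * d.-1%:R by rewrite mulr_ge0 //; lra.
    lra.
  rewrite mul1r.
  (* Here [C <= m], and [d >= 40 ln m] makes [expR (- d / 8)] at most [m ^- 5]. *)
  apply: (@le_trans _ _ (m%:R * m%:R * m%:R ^- 5)).
    apply: ler_pM => //; rewrite ?mulr_ge0 ?expR_ge0 //.
      by rewrite ler_wpM2l // ler_nat.
    by rewrite m_expR ler_expR lerN2; move: d_large; lra.
  rewrite le_eqVlt; apply/orP; left; apply/eqP; field.
  by rewrite pnatr_eq0 -lt0n.
rewrite addnS -natr1 mulrDl mul1r.
apply: le_trans (sparse_step e_sym e_reg d_gt3 m_card m_gt0 _
  (eta := expR (- layer_exp J)) _ _) _.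
- rewrite expR_ge0 expR_le1 oppr_le0; apply: le_trans (layer_exp_ge J); lra.
- have := expR_pow J; set p := _ ^+ _ => hp.
  have p0 : 0 <= p by rewrite exprn_ge0 ?expR_ge0.
  have h4 : 4 * expR 1 * l.+1%:R * p <= expR (- layer_exp J.+1).
    apply: (@le_trans _ _ (expR (l%:R / 16) * expR (- (layer_exp J * l%:R / 2)))).
      by apply: ler_pM => //; rewrite !mulr_ge0 ?expR_ge0.
    by rewrite -expRD ler_expR; move: (l16 J) (layer_expS J); lra.
  have q0 : 0 <= expR 1 * (l.+1%:R * p) by rewrite !mulr_ge0 ?expR_ge0.
  have : expR 1 * (l.+1%:R * p) * d%:R <= expR 1 * (l.+1%:R * p) * (2 * d.-1%:R).
    by rewrite ler_wpM2l.
  have : 4 * expR 1 * l.+1%:R * p * d.-1%:R <= expR (- layer_exp J.+1) * d.-1%:R.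
    by rewrite ler_wpM2r.
  lra.
apply: lerD.
  by apply: IH; apply/implyP => _; apply: implyP hJ _.
apply: (@le_trans _ _ (m%:R * m%:R ^- 5)).
  rewrite ler_wpM2l // m_expR ler_expR lerN2.
  have : expR (- (L / 4)) * d.-1%:R <= expR (- layer_exp J.+1) * d.-1%:R.
    by rewrite ler_wpM2r // ler_expR lerN2 layer_exp_le.
  move: (implyP hJ isT); lra.
rewrite (_ : m%:R * _ = m%:R ^- 4); last by field; rewrite pnatr_eq0 -lt0n.
rewrite lef_pV2 ?posrE ?exprn_gt0 ?ltr0n // ler_weXn2l //.
by move: mR; lra.
Qed.

Lemma max_load_whp J k :
  (0 < J)%N ==> (10 * N <= expR (- (L / 4)) * d.-1%:R) -> (J <= m)%N ->
  20 * N <= l%:R ^+ 2 * layer_exp J * k%:R ->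
  1 - m%:R^-1 <= Pr (fun w => (max_load w <= (C * C).+1 + J + k)%N).
Proof.
move=> hJ Jm hk.
have m_gt0 : (0 < m)%N by apply: leq_trans m_gt384.
have p1 : \sum_(w : history T m l) history_prob R e w = 1.
  exact: (sum_history_prob1 R l e_reg d_gt3 m_card m_gt0).
rewrite (alloc_probC _ p1) lerD2l lerN2.
set c := ((C * C).+1 + J)%N.
have th := layer_exp_ge J.
apply: (@le_trans _ _ (Pr (fun w => (c + k < max_load w)%N))).
  by apply: alloc_prob_le => w _ /=; rewrite ltnNge.
(* With this [x], [(l + 1) ^ 2 <= expR x] and [eta ^ uphalf l <= expR (- 2 x)], so the mean term is
   at most 1, while [hk] gives [x k (l + 1) >= 5 ln m]. Against [m d ^ l <= m ^ 2] this leaves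
   [e m ^- 3]. *)
pose x := l%:R * layer_exp J / 4.
have x0 : 0 <= x by rewrite /x divr_ge0 // mulr_ge0 //; lra.
apply: le_trans (max_load_le e_sym e_irr e_reg d_gt3 girth_l m_card m_gt0 c
  (eta := expR (- layer_exp J)) k _ x0) _.
  by rewrite expR_ge0 expR_le1 oppr_le0; apply: le_trans th => //; lra.
have hS := sparse_layers hJ; rewrite -/c in hS.
set S := alloc_prob _ _ _ _ _ in hS *.
have hE : m%:R * d%:R ^+ l * expR (expR x * (l.+1%:R ^+ 2 * expR (- layer_exp J) ^+ uphalf l)
    - x * (k * l.+1)%:R) <= expR 1 * m%:R ^- 3.
  rewrite -expN -expL -expRM_natl -!expRD expN m_expR -expRD ler_expR.
  have h1 : expR x * (l.+1%:R ^+ 2 * expR (- layer_exp J) ^+ uphalf l) <= 1.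
    apply: (@le_trans _ _ (expR x * (expR (l%:R / 16) * expR (- (layer_exp J * l%:R / 2))))).
      rewrite ler_wpM2l ?expR_ge0 // ler_pM ?exprn_ge0 ?expR_ge0 //.
    by rewrite -!expRD expR_le1 /x; move: (l16 J); lra.
  have h2 : 5 * N <= x * (k * l.+1)%:R.
    apply: (@le_trans _ _ (x * (k * l)%:R)); last by rewrite ler_wpM2l // ler_nat leq_mul2l leqnSn orbT.
    rewrite /x natrM; move: hk; lra.
  move: h1 h2 l_lnd; lra.
apply: (@le_trans _ _ ((J.+1%:R + expR 1) * m%:R ^- 3)).
  by rewrite mulrDl lerD.
have m3 : 0 < m%:R ^+ 3 :> R by rewrite exprn_gt0 // ltr0n.
rewrite ler_pdivrMr //.
have -> : m%:R^-1 * m%:R ^+ 3 = m%:R * m%:R :> R by field; rewrite pnatr_eq0 -lt0n.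
have hJm : J%:R <= m%:R :> R by rewrite ler_nat.
have hCm : C%:R <= m%:R :> R by rewrite ler_nat.
have : 384 * m%:R <= m%:R * m%:R :> R by rewrite ler_wpM2r // ltW.
rewrite -natr1; move: C_large mR; lra.
Qed.


(** * The two regimes of the walk length *)

Hypotheses (N_ge5 : 5 <= N) (LL_ge1 : 1 <= ln N).
Hypotheses (l_ge16 : (16 <= l)%N) (l_gte : 4 * expR 1 <= l%:R :> R).

Local Notation LL := (ln N).
Local Notation G := (logb d%:R m%:R : R).

Let N_gt0 : 0 < N. Proof. by move: N_ge5; lra. Qed.

Let L_gt0 : 0 < L. Proof. by move: lnd_ge1; lra. Qed.

Let l_gt0 : 0 < l%:R :> R. Proof. by rewrite ltr0n (leq_trans _ l_gt3). Qed.

Let l_leG : l%:R <= G. Proof. by rewrite /logb ler_pdivlMr. Qed.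

Let r_gt0 : 0 < l%:R / 4 :> R. Proof. by rewrite divr_gt0. Qed.

Let lnr_ge1 : 1 <= ln (l%:R / 4) :> R.
Proof. by rewrite -[leLHS]expRK ler_ln ?posrE ?expR_gt0 // ler_pdivlMr // mulrC. Qed.

Let ceil_nat (x : R) : 0 <= x -> exists2 k : nat, x <= k%:R & k%:R <= x + 1.
Proof.
move=> x0; exists (Num.truncn x).+1; first exact/ltW/truncnS_gt.
by rewrite -natr1 lerD2r truncn_le.
Qed.

(* When [d] is at most a power of [ln n] the first layer suffices; otherwise
   the layers bring the exponent up to [ln d / 4]. *)
Lemma max_load_explicit :
  1 - m%:R^-1 <= Pr (fun w => (max_load w)%:R <=
    (C * C)%:R + 3 + LL / ln (l%:R / 4) + 320 * (G * LL / l%:R ^+ 2)).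
Proof.
have l2 : 0 < l%:R ^+ 2 :> R by rewrite exprn_gt0.
have LLr0 : 0 <= LL / ln (l%:R / 4).
  by rewrite divr_ge0 //; [move: LL_ge1 | move: lnr_ge1]; lra.
have G0 : 0 < G by rewrite divr_gt0.
suff [J [k [hJ Jm hk J_le k_le]]] : exists J k : nat,
    [/\ (0 < J)%N ==> (10 * N <= expR (- (L / 4)) * d.-1%:R), (J <= m)%N,
        20 * N <= l%:R ^+ 2 * layer_exp J * k%:R,
        J%:R <= LL / ln (l%:R / 4) + 1
      & k%:R <= 320 * (G * LL / l%:R ^+ 2) + 1].
  apply: le_trans (max_load_whp hJ Jm hk) _; apply: alloc_prob_le => w _ /= h.
  have {}h : (max_load w)%:R <= ((C * C).+1 + J + k)%:R :> R by rewrite ler_nat.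
  by apply: le_trans h _; rewrite !natrD -natr1; lra.
have [dN|dN] := leP L (4 * LL).
  (* [layer_exp 0 = 1 / 4] asks for [k >= 80 N / l ^ 2], and [N = G * L <= 4 * G * LL] yields
     320. *)
  have x0 : 0 <= 80 * N / l%:R ^+ 2 by rewrite divr_ge0 ?mulr_ge0 // ltW.
  have [k xk kx] := ceil_nat x0.
  exists 0%N, k; split=> //.
  - by move: xk; rewrite layer_exp0 ler_pdivrMr //; lra.
  - by rewrite addr_ge0.
  apply: le_trans kx _; rewrite lerD2r mulrA ler_wpM2r ?invr_ge0 ?(ltW l2) //.
  have NGL : N = G * L by rewrite /logb divfK // gt_eqF.
  by have := ler_wpM2l (ltW G0) dN; lra.
(* Here [layer_exp J] will be [L / 4], and [20 N = 20 G L] asks for [k >= 80 G / l ^ 2]. *)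
have x0 : 0 <= 80 * G / l%:R ^+ 2.
  by rewrite divr_ge0 ?(ltW l2) // mulr_ge0 // (ltW G0).
have [k xk kx] := ceil_nat x0.
have [J xJ Jx] := ceil_nat LLr0.
(* The power reaches [N], hence [L], so the minimum in [layer_exp J] is [L]. *)
have rJ : N <= (l%:R / 4) ^+ J.
  rewrite -ler_ln ?posrE ?exprn_gt0 // lnXn // -[leRHS]mulr_natl -ler_pdivrMr //.
  by move: lnr_ge1; lra.
have LN : L <= N.
  have : 1 * L <= l%:R * L by rewrite ler_wpM2r ?(ltW L_gt0) // ler1n (leq_trans _ l_gt3).
  by move: l_lnd; lra.
have thJ : layer_exp J = L / 4 by rewrite /layer_exp (min_idPr _) // (le_trans LN).
exists J, k; split => //.
- apply/implyP => _.
  have d2 : expR L <= 2 * d.-1%:R.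
    by rewrite expL -natrM ler_nat leq_double_pred // (leq_trans _ d_gt3).
  (* [L > 4 LL] says [d > N ^ 4], so [d ^ (3/4) >= N ^ 3 >= 25 N], of which at least half remains on
     passing from [d] to [d - 1]. *)
  have h3 : N ^+ 3 <= expR (- (L / 4)) * expR L.
    rewrite -expRD -[N in N ^+ 3]lnK ?posrE // -expRM_natl ler_expR; lra.
  have : expR (- (L / 4)) * expR L <= expR (- (L / 4)) * (2 * d.-1%:R).
    by rewrite ler_wpM2l ?expR_ge0.
  have : 25 * N <= N ^+ 3.
    rewrite exprSr ler_wpM2r ?(ltW N_gt0) // expr2; move: N_ge5; nra.
  move: N_ge5 h3; set a := expR (- (L / 4)) * expR L; set b := N ^+ 3.
  rewrite mulrCA; lra.
- rewrite -(ler_nat R); apply: le_trans Jx _.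
  have : LL / ln (l%:R / 4) <= LL.
    by rewrite ler_pdivrMr ?ler_peMr //; move: LL_ge1 lnr_ge1; lra.
  have := ln_sublinear N_gt0; have := expR_ge1Dx N; rewrite expN; lra.
- move: xk; rewrite thJ ler_pdivrMr // => xk.
  have NGL : N = G * L by rewrite /logb divfK // gt_eqF.
  have := ler_wpM2r (ltW L_gt0) xk; lra.
apply: le_trans kx _; rewrite lerD2r mulrA ler_wpM2r ?invr_ge0 ?(ltW l2) //.
have : G * 1 <= G * LL by rewrite ler_wpM2l // ltW.
lra.
Qed.

Let K : R := 16 * ((C * C)%:R + 3) + 336.

Let CC0 : 0 <= (C * C)%:R :> R. Proof. by []. Qed.

(** Here [l ^ 2 <= 16 G], so [LL <= 16 Y] for the target [Y]. The terms of [max_load_explicit] are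
    then at most [16 (C * C + 3) Y], [16 Y] and [320 Y], which add up to [K * Y]. *)
Lemma max_load_short_walk : l%:R <= 4 * gammaG R m d ->
  1 - m%:R^-1 <= Pr (fun w => (max_load w)%:R <= K * (G * LL / l%:R ^+ 2)).
Proof.
move=> lG; apply: le_trans max_load_explicit _; apply: alloc_prob_le => w _ /= h.
apply: le_trans h _.
have G0 : 0 < G by rewrite divr_gt0.
have l2 : 0 < l%:R ^+ 2 :> R by rewrite exprn_gt0.
have lG2 : l%:R ^+ 2 <= 16 * G.
  rewrite -[G]sqr_sqrtr ?(ltW G0) //; move: lG; rewrite /gammaG; set g := Num.sqrt _ => lG.
  have := ler_pM (ltW l_gt0) (ltW l_gt0) lG lG; rewrite !expr2; lra.
set Y := G * LL / l%:R ^+ 2.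
have YL : LL <= 16 * Y.
  rewrite /Y mulrA ler_pdivlMr // mulrA mulrC ler_wpM2r //.
  by move: LL_ge1; lra.
have : LL / ln (l%:R / 4) <= LL.
  by rewrite ler_pdivrMr ?ler_peMr //; move: LL_ge1 lnr_ge1; lra.
have : ((C * C)%:R + 3) * 1 <= ((C * C)%:R + 3) * (16 * Y).
  by rewrite ler_wpM2l ?addr_ge0 //; move: LL_ge1 YL; lra.
rewrite /K; move: YL; lra.
Qed.

(** Put [g = gammaG R m d] and [x = l / g]. From [16 <= l <= g ^ 2] follow [4 <= g], [x <= l / 4]
    and [x <= g <= N], so [LL / ln x] dominates both 1 and the number of layers; moreover
    [G / l ^ 2 = 1 / x ^ 2 <= 1 / ln x]. *)
Lemma max_load_long_walk : 4 * gammaG R m d <= l%:R ->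
  1 - m%:R^-1 <= Pr (fun w => (max_load w)%:R <= K * (LL / ln (l%:R / gammaG R m d))).
Proof.
move=> lG; apply: le_trans max_load_explicit _; apply: alloc_prob_le => w _ /= h.
apply: le_trans h _.
have G0 : 0 < G by rewrite divr_gt0.
have gG : gammaG R m d ^+ 2 = G by rewrite /gammaG sqr_sqrtr ?(ltW G0).
move: lG gG; set g := gammaG R m d => lG gG.
have g0 : 0 < g by rewrite /g /gammaG sqrtr_gt0.
have l16R : 16 <= l%:R :> R by rewrite ler_nat.
have g4 : 4 <= g by rewrite -(ler_pXn2r (n := 2)) ?nnegrE ?(ltW g0) // gG; move: l_leG; lra.
pose x := l%:R / g.
have lx : l%:R = x * g by rewrite /x divfK // gt_eqF.
have x4 : 4 <= x by rewrite ler_pdivlMr.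
have x0 : 0 < x by lra.
have xg : x <= g by rewrite /x ler_pdivrMr // -expr2 gG.
have gN : g <= N.
  rewrite -(ler_pXn2r (n := 2)) ?nnegrE ?(ltW g0) ?(ltW N_gt0) // gG /logb ler_pdivrMr //.
  have : N ^+ 2 * 1 <= N ^+ 2 * L by rewrite ler_wpM2l ?exprn_ge0 // ltW.
  by move: N_ge5; rewrite expr2; nra.
have xr : x <= l%:R / 4.
  by rewrite lx ler_pdivlMr // ler_wpM2l // ltW.
have lnx_gt0 : 0 < ln x by rewrite ln_gt0 //; lra.
have lnx_LL : ln x <= LL by rewrite ler_ln ?posrE // (le_trans xg).
have lnx_r : ln x <= ln (l%:R / 4) by rewrite ler_ln ?posrE.
have lnx_x : ln x <= x ^+ 2 by have := ln_sublinear x0; rewrite expr2; nra.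
rewrite -/x; set Y := LL / ln x.
have LL0 : 0 <= LL by move: LL_ge1; lra.
have Y1 : 1 <= Y by rewrite /Y ler_pdivlMr // mul1r.
have : LL / ln (l%:R / 4) <= Y.
  by rewrite ler_wpM2l // lef_pV2 ?posrE // (lt_le_trans lnx_gt0).
have : G * LL / l%:R ^+ 2 <= Y.
  have -> : G * LL / l%:R ^+ 2 = LL / x ^+ 2.
    by rewrite lx -gG; field; rewrite !gt_eqF.
  by rewrite ler_wpM2l // lef_pV2 ?posrE // exprn_gt0.
have : (16 * ((C * C)%:R + 3)) * 1 <= (16 * ((C * C)%:R + 3)) * Y.
  by rewrite ler_wpM2l // mulr_ge0 // addr_ge0.
rewrite /K; move: CC0; lra.
Qed.

End FixedGraph.

(** * Asymptotics *)

Lemma cvg_nat_near_ge (R : realType) (u : nat -> nat) (M : R) :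
  u i @[i --> \oo] --> \oo -> \forall i \near \oo, M <= (u i)%:R.
Proof.
move=> u_oo; have h : \forall i \near \oo, ((Num.truncn M).+1 <= u i)%N.
  exact: u_oo (nbhs_infty_ge _).
apply: filterS h => i h.
by apply: le_trans (ltW (truncnS_gt M)) _; rewrite ler_nat.
Qed.

(** [kpar >= 4] and [1 < ln n] make [hpar] positive, so every cycle has at least [10 l] vertices,
    more than the [l] that [walk_uniq] asks for. *)
Lemma cycle_size_gt (R : realType) (T : finType) (e : rel T) (n d l : nat) :
  1 < ln n%:R :> R -> (0 < l)%N ->
  ((10 * hpar R n d l * l%:Z)%:~R%:E <= girth e R)%E ->
  forall c : seq T, (2 < size c)%N -> ucycle e c -> (l < size c)%N.
Proof.
move=> N1 l0 hg c c2 cc.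
have h0 : 0 < hpar R n d l.
  rewrite /hpar ceil_gt0 divr_gt0 // ln_gt0 //.
  have : 4%:Z <= kpar R n d l by rewrite /kpar le_max lexx.
  by move=> k4; rewrite -[1]/(1%:~R) ltr_int; lia.
have : ((10 * hpar R n d l * l%:Z)%:~R%:E <= (size c)%:R%:E :> \bar R)%E.
  by apply: le_trans hg _; apply: ereal_inf_lbound; exists c.
rewrite lee_fin -[(size c)%:R]/((size c)%:Z%:~R) ler_int.
have : 1 * l%:Z <= hpar R n d l * l%:Z by rewrite ler_wpM2r.
lia.
Qed.

(** For [y = l / 16 >= 100], the Taylor term [y ^ 4 / 24] of [expR y] exceeds [(16 y + 1) ^ 2]. *)
Lemma sqr_le_expR (R : realType) (l : nat) :
  16 * 100 <= l%:R :> R -> l.+1%:R ^+ 2 <= expR (l%:R / 16) :> R.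
Proof.
rewrite mulrC -ler_pdivlMr // -[l.+1%:R]natr1; set y := l%:R / 16 => hy.
have -> : l%:R = 16 * y :> R by rewrite /y mulrC divfK.
have y0 : 0 <= y by rewrite divr_ge0 // ler0n.
apply: le_trans (expR_ge1Dxn 3 y0).
have -> : 4`!%:R = 24 :> R by [].
have hyy : 100 * y <= y * y by rewrite ler_wpM2r.
have y2 : 0 <= y * y by rewrite mulr_ge0.
have : 100 * 100 * (y * y) <= y * y * (y * y).
  by rewrite ler_wpM2r // ler_pM // ler0n.
have -> : y ^+ 4 = y * y * (y * y) by rewrite !exprS expr0; ring.
rewrite expr2; lra.
Qed.

Unset Implicit Arguments.
Set Strict Implicit.
Set Printing Implicit Defensive.

Theorem mainTheorem1 (R : realType)
    (V : nat -> finType) (E : forall i, rel (V i)) (n d l : nat -> nat)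
    (hn : forall i, #|V i| = n i)
    (hn_oo : n i @[i --> \oo] --> \oo)
    (hE : forall i, simple_graph (E i))
    (hreg : forall i, regular (E i) (d i))
    (hd : (fun i => ln (n i)%:R : R) =o_\oo (fun i => (d i)%:R : R))
    (hl_pos : forall i, (0 < l i)%N)
    (hl_oo : l i @[i --> \oo] --> \oo)
    (hl : (fun i => (l i)%:R : R) =o_\oo (fun i => logb (d i)%:R (n i)%:R : R))
    (hgirth : forall i,
      ((10 * hpar R (n i) (d i) (l i) * (l i)%:Z)%:~R%:E <= girth (E i) R)%E) :
  exists C c : R, [/\ 0 < C, 0 < c &
    \forall i \near \oo,
      ((l i)%:R <= 4 * gammaG R (n i) (d i) ->
        1 - (n i)%:R `^ (- c) <=
        alloc_prob R (E i) (n i) (l i)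
          (fun w => (max_load w)%:R <=
             C * (logb (d i)%:R (n i)%:R * ln (ln (n i)%:R) / (l i)%:R ^+ 2)))
      /\
      (4 * gammaG R (n i) (d i) <= (l i)%:R ->
        1 - (n i)%:R `^ (- c) <=
        alloc_prob R (E i) (n i) (l i)
          (fun w => (max_load w)%:R <=
             C * (ln (ln (n i)%:R) / ln ((l i)%:R / gammaG R (n i) (d i)))))].
Proof.
have [C C_large] : exists C : nat, 384 * expR 1 <= C%:R :> R.
  by exists (Num.truncn (384 * expR 1 : R)).+1; apply/ltW/truncnS_gt.
have e1 : 1 < expR 1 :> R by rewrite expR_gt1.
exists (16 * ((C * C)%:R + 3) + 336), 1; split; [|exact: ltr01|].
  by rewrite ltr_wpDl ?ltr0n // mulr_ge0 ?addr_ge0 ?ler0n.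
have h40 : 0 < 1 / 40 :> R by rewrite divr_gt0 // ltr0n.
have /eqoP/(_ _ h40) d_near := hd; have /eqoP/(_ 1 ltr01) ld_near := hl.
(* [ln n >= e + 5] gives both [N_ge5] and [LL_ge1]; the summand [C] gives [C <= n]. *)
have n_near := cvg_nat_near_ge (C%:R + expR (expR 1 + 5) : R) hn_oo.
(* The term [16 * 100] serves [sqr_le_expR]; the summand [C >= 384 e] gives [l >= 4 e]. *)
have l_near := cvg_nat_near_ge (C%:R + 16 * 100 : R) hl_oo.
near=> i.
pose N : R := ln (n i)%:R.
have n_large : C%:R + expR (expR 1 + 5) <= (n i)%:R :> R by near: i; exact: n_near.
have l_large : C%:R + 16 * 100 <= (l i)%:R :> R by near: i; exact: l_near.
have n0 : 0 < (n i)%:R :> R.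
  by apply: lt_le_trans n_large; rewrite ltr_wpDl ?expR_gt0.
have N_large : expR 1 + 5 <= N.
  rewrite /N -[leLHS]expRK ler_ln ?posrE ?expR_gt0 //.
  by apply: le_trans n_large; rewrite lerDr.
have N0 : 0 < N by lra.
have d_large : 40 * N <= (d i)%:R.
  have : `|ln (n i)%:R : R| <= 1 / 40 * `|(d i)%:R : R|.
    by near: i; exact: d_near.
  rewrite -/N !ger0_norm ?(ltW N0) //; lra.
have d0 : 0 < (d i)%:R :> R by lra.
have lnd_ge1 : 1 <= ln (d i)%:R :> R.
  by rewrite -[leLHS]expRK ler_ln ?posrE ?expR_gt0 //; lra.
have d_gt3 : (3 < d i)%N by rewrite -(ltr_nat R); lra.
have l_lnd : (l i)%:R * ln (d i)%:R <= N.
  have : `|(l i)%:R : R| <= 1 * `|logb (d i)%:R (n i)%:R : R|.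
    by near: i; exact: ld_near.
  have L0 : 0 < ln (d i)%:R :> R by lra.
  rewrite mul1r !ger0_norm ?ler0n //; first by rewrite /logb ler_pdivlMr.
  by rewrite divr_ge0 ?(ltW L0) ?(ltW N0).
have C_le_n : (C <= n i)%N.
  by rewrite -(ler_nat R); apply: le_trans n_large; rewrite lerDl expR_ge0.
have l_large2 := sqr_le_expR (R := R) (l := l i).
have {}l_large2 : (l i).+1%:R ^+ 2 <= expR ((l i)%:R / 16) :> R.
  by apply: l_large2; apply: le_trans l_large; rewrite lerDr.
have C0 : 0 <= C%:R :> R by [].
have l_gte : 4 * expR 1 <= (l i)%:R :> R by lra.
have l_large1 : 4 * expR 1 * (l i).+1%:R <= expR ((l i)%:R / 16) :> R.
  apply: le_trans l_large2; rewrite expr2 ler_wpM2r // -natr1; lra.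
have l_ge16 : (16 <= l i)%N by rewrite -(ler_nat R); lra.
have l_gt3 : (3 < l i)%N by apply: leq_trans l_ge16.
have LL_ge1 : 1 <= ln N.
  by rewrite -[leLHS]expRK ler_ln ?posrE ?expR_gt0 //; lra.
have N_ge5 : 5 <= N by lra.
have N_gt1 : 1 < N by lra.
have [e_sym e_irr] := hE i.
have girth_l := cycle_size_gt N_gt1 (hl_pos i) (hgirth i).
rewrite powR_inv1 ?(ltW n0) //; split => hli.
  exact: (max_load_short_walk e_sym e_irr (hreg i) d_gt3 girth_l (hn i) C_le_n).
exact: (max_load_long_walk e_sym e_irr (hreg i) d_gt3 girth_l (hn i) C_le_n).
Unshelve. all: by end_near.
Qed.
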